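(* Let $\eta\in(1,\infty)$, $\alpha\in[\eta,\infty)$ and $\beta>\alpha^d$. Then $rbmo^{1}_{\mathscr Q}(\mu)=rbmo^{3}_{\mathscr Q}(\mu)=rbmo^{4}_{\mathscr Q}(\mu)$ with equivalent norms; that is, the three spaces coincide as subsets of $L_{loc}(\mu)$, and there is a constant $C\ge1$, independent of $f$, such that $C^{-1}\|f\|_{*i}\le\|f\|_{*j}\le C\|f\|_{*i}$ for all $i,j\in\{1,3,4\}$ and all $f$ in this common space.
   Context: Let $d\ge 1$ be an integer, $0<n\le d$, and let $\mu$ be a positive Radon measure on $\mathbb R^{d}$ satisfying the growth condition $\mu(Q(x,l))\le C_{0}l^{n}$ for all $x\in\mathbb R^{d}$, $l>0$, with a fixed constant $C_0>0$, where $Q(x,l)$ is the cube centered at $x$ with side length $l$. The measure $\mu$ is not assumed to be doubling. A cube is a closed cube in $\mathbb R^d$ with sides parallel to the coordinate axes; $l(Q)$ is the side length of $Q$ and, for $\lambda>0$, $\lambda Q$ is the cube concentric with $Q$ of side length $\lambda l(Q)$. $L_{loc}(\mu)$ is the space of real-valued locally $\mu$-integrable functions, and $m_Qf=\frac1{\mu(Q)}\int_Q f\,d\mu$. Doubling cubes: with $\alpha>1$ and $\beta>\alpha^d$ fixed, a cube $Q$ is $(\alpha,\beta)$-doubling if $\mu(\alpha Q)\le\beta\mu(Q)$. For a cube $Q$, $\widetilde Q$ is the smallest $(\alpha,\beta)$-doubling cube of the form $\alpha^mQ$ with $m\in\{0,1,2,\dots\}$, and $Q'$ is the biggest $(\alpha,\beta)$-doubling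 cube of the form $\alpha^{-N}Q$ with $N\in\{1,2,\dots\}$. (The assumption $\beta>\alpha^d$ is made to guarantee existence of these cubes; for a given side length, $Q'$ exists for $\mu$-almost every center.) Put $\mathscr Q=\{Q: l(Q)\le 1\}$ and $\mathscr Q_{ex}=\{Q: l(Q')\le 1\}$, where $Q\in\mathscr Q_{ex}$ means that $Q'$ exists and $l(Q')\le1$. For cubes $Q\subset R$, $K_{Q,R}=1+\sum_{k=1}^{N_{Q,R}}\frac{\mu(2^kQ)}{l(2^kQ)^n}$, where $N_{Q,R}$ is the first integer $k\ge 0$ with $l(2^kQ)\ge l(R)$. Conditions below involving means or quotients with a measure in the denominator are imposed only for cubes for which these are defined (positive denominators). $rbmo^1_{\mathscr Q}(\mu)$: the set of $f\in L_{loc}(\mu)$ for which there is a constant $C_3\ge0$ such that (a) for every cube $Q\in\mathscr Q$, $\frac1{\mu(\eta Q)}\int_Q|f-m_{\widetilde Q}f|\,d\mu\le C_3$; (b) for any two $(\alpha,\beta)$-doubling cubes $Q\subset R$ with $Q\in\mathscr Q$ and $R\in\mathscr Q_{ex}$, $|m_Qf-m_Rf|\le C_3K_{Q,R}$; (c) for every cube $Q\in\mathscr Q_{ex}\setminus\mathscr Q$, $\frac1{\mu(\eta Q)}\int_Q|f|\,d\mu\le C_3$. The norm $\|f\|_{*1}$ is the infimum of such $C_3$. $rbmo^3_{\mathscr Q}(\mu)$: the set of $f\in L_{loc}(\mu)$ for which there is a constant $C_5\ge0$ such that (a) for every cube $Q\in\mathscr Q$, $\frac1{\mu(\eta Q)}\int_Q|f-m_Qf|\,d\mu\le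 C_5$; (b) for any two cubes $Q\subset R$ with $Q\in\mathscr Q$ and $R\in\mathscr Q_{ex}$, $|m_Qf-m_Rf|\le C_5K_{Q,R}\left[\frac{\mu(\eta Q)}{\mu(Q)}+\frac{\mu(\eta R)}{\mu(R)}\right]$; (c) for every cube $Q\in\mathscr Q_{ex}\setminus\mathscr Q$, $\frac1{\mu(\eta Q)}\int_Q|f|\,d\mu\le C_5$. The norm $\|f\|_{*3}$ is the minimal such $C_5$. $rbmo^4_{\mathscr Q}(\mu)$: the set of $f\in L_{loc}(\mu)$ for which there is a constant $C_6\ge0$ such that (a) for every $(\alpha,\beta)$-doubling cube $Q\in\mathscr Q$, $\frac1{\mu(Q)}\int_Q|f-m_Qf|\,d\mu\le C_6$; (b) for any two $(\alpha,\beta)$-doubling cubes $Q\subset R$ with $Q\in\mathscr Q$ and $R\in\mathscr Q_{ex}$, $|m_Qf-m_Rf|\le C_6K_{Q,R}$; (c) for every $(\alpha,\beta)$-doubling cube $Q\in\mathscr Q_{ex}\setminus\mathscr Q$, $\frac1{\mu(Q)}\int_Q|f|\,d\mu\le C_6$. The norm $\|f\|_{*4}$ is the minimal such $C_6$. *)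

(* Defs.v *)
From HB Require Import structures.
From mathcomp Require Import all_boot all_order all_algebra.
From mathcomp Require Import all_classical all_reals all_analysis.
Set Implicit Arguments.
Unset Strict Implicit.
Unset Printing Implicit Defensive.
Import Order.TTheory GRing.Theory Num.Theory.
Import numFieldNormedType.Exports.
Local Open Scope classical_set_scope.
Local Open Scope ring_scope.

(* R^d with its Borel sigma-algebra.  As a type this is ['rV[R]_d]. *)
Definition Rd (R : realType) (d : nat) :=
  g_sigma_algebraType (@open 'rV[R]_d).

(* Finiteness on compact sets, outer regularity on Borel sets and inner
   regularity on open sets. *)
Definition radon (R : realType) (d : nat)
    (mu : {measure set (Rd R d) -> \bar R}) : Prop :=
  [/\ forall A : set 'rV[R]_d, compact A -> (mu A < +oo)%E,
      forall A : set (Rd R d), measurable A ->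
        mu A = ereal_inf [set mu U | U in [set U : set 'rV[R]_d |
                                            open U /\ A `<=` U]]
    & forall U : set 'rV[R]_d, open U ->
        mu U = ereal_sup [set mu A | A in [set A : set 'rV[R]_d |
                                            compact A /\ A `<=` U]] ].

(* Elements of L_loc(mu) are represented by Borel measurable functions. *)
Definition loc_integrable (R : realType) (d : nat)
    (mu : {measure set (Rd R d) -> \bar R}) (f : Rd R d -> R) : Prop :=
  measurable_fun [set: Rd R d] f /\
  forall A : set 'rV[R]_d, compact A -> mu.-integrable A (EFin \o f).

(* A cube is given by its center and its side length.  Positivity of the side
   is not part of the record; it is required in [unit_cubes], in
   [extended_cubes] and in [growth], hence wherever cubes are quantified. *)
Record cube (R : realType) (d : nat) :=
  Cube { center : 'rV[R]_d ; side : R }.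

Definition cube_set (R : realType) (d : nat) (Q : cube R d) : set (Rd R d) :=
  [set y : 'rV[R]_d |
    forall i, `|y ord0 i - center Q ord0 i| <= side Q / 2].

Definition dilate (R : realType) (d : nat) (c : R) (Q : cube R d) : cube R d :=
  Cube (center Q) (c * side Q).

Definition subcube (R : realType) (d : nat) (Q S : cube R d) : Prop :=
  cube_set Q `<=` cube_set S.

Definition growth (R : realType) (d : nat) (n C0 : R)
    (mu : {measure set (Rd R d) -> \bar R}) : Prop :=
  forall Q : cube R d, 0 < side Q ->
    (mu (cube_set Q) <= (C0 * side Q `^ n)%:E)%E.

Section Rbmo.
Context (R : realType) (d : nat) (n : R).
Context (mu : {measure set (Rd R d) -> \bar R}).
Context (alpha beta eta : R).

(* Cubes have finite measure under [growth], so that [fine] loses nothing. *)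
Definition mass (Q : cube R d) : R := fine (mu (cube_set Q)).

Definition integral_on (Q : cube R d) (f : Rd R d -> R) : R :=
  \int[mu]_(x in cube_set Q) f x.

Definition mean (Q : cube R d) (f : Rd R d -> R) : R :=
  (mass Q)^-1 * integral_on Q f.

Definition doubling (Q : cube R d) : Prop :=
  mass (dilate alpha Q) <= beta * mass Q.

(* [is_tilde Q Qt] : Qt is the smallest doubling cube alpha^m Q, m >= 0. *)
Definition is_tilde (Q Qt : cube R d) : Prop :=
  exists m : nat,
    [/\ Qt = dilate (alpha ^+ m) Q, doubling Qt
      & forall k : nat, (k < m)%N -> ~ doubling (dilate (alpha ^+ k) Q)].

(* [is_prime Q Qp] : Qp is the biggest doubling cube alpha^(-N) Q, N >= 1. *)
Definition is_prime (Q Qp : cube R d) : Prop :=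
  exists N : nat,
    [/\ (0 < N)%N, Qp = dilate (alpha ^- N) Q, doubling Qp
      & forall k : nat, (0 < k < N)%N -> ~ doubling (dilate (alpha ^- k) Q)].

Definition unit_cubes : set (cube R d) :=
  [set Q | 0 < side Q /\ side Q <= 1].

Definition extended_cubes : set (cube R d) :=
  [set Q | 0 < side Q /\ exists2 Qp, is_prime Q Qp & side Qp <= 1].

(* The first k >= 0 with l(2^k Q) >= l(S); it exists as soon as l(Q) > 0. *)
Definition scale_gap (Q S : cube R d) : nat :=
  xget 0%N [set k : nat | side S <= side (dilate (2 ^+ k) Q) /\
    forall j : nat, (j < k)%N -> side (dilate (2 ^+ j) Q) < side S].

Definition Kcoef (Q S : cube R d) : R :=
  1 + \sum_(1 <= k < (scale_gap Q S).+1)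
        mass (dilate (2 ^+ k) Q) / side (dilate (2 ^+ k) Q) `^ n.

Definition rbmo_cond1 (f : Rd R d -> R) (C : R) : Prop :=
  [/\ forall Q Qt, unit_cubes Q -> is_tilde Q Qt ->
        0 < mass (dilate eta Q) -> 0 < mass Qt ->
        (mass (dilate eta Q))^-1 *
          integral_on Q (fun x => `|f x - mean Qt f|) <= C,
      forall Q S, unit_cubes Q -> extended_cubes S -> subcube Q S ->
        doubling Q -> doubling S -> 0 < mass Q -> 0 < mass S ->
        `|mean Q f - mean S f| <= C * Kcoef Q S
    & forall Q, (extended_cubes `\` unit_cubes) Q ->
        0 < mass (dilate eta Q) ->
        (mass (dilate eta Q))^-1 * integral_on Q (fun x => `|f x|) <= C ].

Definition rbmo_cond3 (f : Rd R d -> R) (C : R) : Prop :=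
  [/\ forall Q, unit_cubes Q -> 0 < mass Q -> 0 < mass (dilate eta Q) ->
        (mass (dilate eta Q))^-1 *
          integral_on Q (fun x => `|f x - mean Q f|) <= C,
      forall Q S, unit_cubes Q -> extended_cubes S -> subcube Q S ->
        0 < mass Q -> 0 < mass S ->
        `|mean Q f - mean S f| <=
          C * Kcoef Q S *
            (mass (dilate eta Q) / mass Q + mass (dilate eta S) / mass S)
    & forall Q, (extended_cubes `\` unit_cubes) Q ->
        0 < mass (dilate eta Q) ->
        (mass (dilate eta Q))^-1 * integral_on Q (fun x => `|f x|) <= C ].

Definition rbmo_cond4 (f : Rd R d -> R) (C : R) : Prop :=
  [/\ forall Q, unit_cubes Q -> doubling Q -> 0 < mass Q ->
        (mass Q)^-1 * integral_on Q (fun x => `|f x - mean Q f|) <= C,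
      forall Q S, unit_cubes Q -> extended_cubes S -> subcube Q S ->
        doubling Q -> doubling S -> 0 < mass Q -> 0 < mass S ->
        `|mean Q f - mean S f| <= C * Kcoef Q S
    & forall Q, (extended_cubes `\` unit_cubes) Q -> doubling Q ->
        0 < mass Q ->
        (mass Q)^-1 * integral_on Q (fun x => `|f x|) <= C ].

End Rbmo.

Inductive rbmo_index : Set := rbmo1 | rbmo3 | rbmo4.

Definition rbmo_cond (R : realType) (d : nat) (n : R)
    (mu : {measure set (Rd R d) -> \bar R}) (alpha beta eta : R)
    (i : rbmo_index) : (Rd R d -> R) -> R -> Prop :=
  match i with
  | rbmo1 => rbmo_cond1 n mu alpha beta eta
  | rbmo3 => rbmo_cond3 n mu alpha beta eta
  | rbmo4 => rbmo_cond4 n mu alpha beta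
  end.

Definition rbmo (R : realType) (d : nat) (n : R)
    (mu : {measure set (Rd R d) -> \bar R}) (alpha beta eta : R)
    (i : rbmo_index) : set (Rd R d -> R) :=
  [set f | loc_integrable mu f /\
           exists2 C : R, 0 <= C & rbmo_cond n mu alpha beta eta i f C].

Definition rbmo_norm (R : realType) (d : nat) (n : R)
    (mu : {measure set (Rd R d) -> \bar R}) (alpha beta eta : R)
    (i : rbmo_index) (f : Rd R d -> R) : R :=
  inf [set C : R | 0 <= C /\ rbmo_cond n mu alpha beta eta i f C].

(* Main.v *)
Require Import Defs.
From mathcomp Require Import all_boot all_order all_algebra.
From mathcomp Require Import all_classical all_reals all_analysis.
From mathcomp Require Import measurable_realfun ring lra.
Set Implicit Arguments.
Unset Strict Implicit.
Unset Printing Implicit Defensive.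
Import Order.TTheory GRing.Theory Num.Theory.
Import numFieldNormedType.Exports.
Local Open Scope classical_set_scope.
Local Open Scope ring_scope.

(** Testing the first or the third condition on doubling cubes gives the fourth
    one at once, because [eta <= alpha] makes [mass (dilate eta Q)] comparable
    to [mass Q] when [Q] is doubling.  The content is the converse: what is
    known on doubling cubes extends to all cubes.

    Two facts make doubling cubes plentiful.  Going up from a cube of positive
    mass, a dilate [alpha ^+ m] of it is doubling, since otherwise the masses
    would grow like [beta ^+ m], faster than the growth condition allows
    ([exists_doubling]).  Going down, almost every point is the center of
    arbitrarily small doubling cubes, because [beta > alpha ^+ d]: points
    without them are covered by about [alpha ^+ (k d)] cubes of mass
    [O(beta ^- k)] ([nondoubling_null]).  In both directions the intermediate
    dilates are not doubling, so their densities form a geometric series and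
    contribute a bounded amount to any coefficient [Kcoef]
    ([nondoubling_density_sum]).

    Let [f] satisfy the fourth condition, and let [Q] be any cube of side at
    most one.  For almost every [x] in [Q] take the largest doubling cube [P]
    with center [x] in a chain that starts just below the scale of [Q]; it lies
    in [dilate eta Q], and [f] oscillates little on it.  If the tilde [Qt] of [Q]
    has side less than [1 / 2], [P] and [Qt] lie in a common doubling cube [S] with center [x],
    and both coefficients are bounded, so that the mean of [f] over [P] is close
    to that over [Qt].  Besicovitch's covering theorem extracts cubes [P] that
    cover almost all of [Q] with overlap at most [2 ^ d]; summing over them
    gives the first condition for [Q] ([tilde_osc]).  The third follows for
    [Q] and [S] by passing through the tildes of both, whose means are compared
    in a doubling cube that contains the two ([tilde_mean_diff]).

    The delicate point is the scale one.  The tilde of a unit cube may be large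
    and have no doubling cube below it, and then it is not an extended cube, so
    that the fourth condition says nothing about it.  Yet the first doubling
    dilate, of side above [t <= 1], of a doubling cube of side at most [t] always
    is an extended cube ([next_doubling]).  Hence small doubling cubes that reach
    scale one with bounded density sums have bounded means
    ([doubling_mean_le]), and the covering argument transfers this bound to all
    cubes of side at least [1 / 2], extended or not, and to the unit cubes with
    a large tilde ([integral_norm_le]). *)

(** * Cubes, their masses, and integrals over them *)

Section CubeGeometry.
Context {R : realType} {d : nat}.
Implicit Types (x y z : 'rV[R]_d) (r s t : R).

Lemma cube_sym x y s : cube_set (Cube x s) y -> cube_set (Cube y s) x.
Proof. by move=> h i; have := h i; rewrite /= distrC. Qed.

Lemma cube_center x s : 0 <= s -> cube_set (Cube x s) x.
Proof. by move=> s0 i; rewrite /= subrr normr0 divr_ge0. Qed.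

Lemma cube_subset x y r s t :
  cube_set (Cube y r) x -> r + s <= t ->
  cube_set (Cube x s) `<=` cube_set (Cube y t).
Proof.
move=> xy rst z zx i; have := xy i; have := zx i => /= h1 h2.
rewrite -(subrKA (x ord0 i)); apply: (le_trans (ler_normD _ _)).
apply: le_trans (lerD h1 h2) _.
by rewrite -mulrDl ler_pM2r ?invr_gt0// addrC.
Qed.

Lemma cube_subset_concentric x s t : s <= t ->
  cube_set (Cube x s) `<=` cube_set (Cube x t).
Proof.
by move=> st; apply: (@cube_subset _ _ 0); rewrite ?add0r//; exact: cube_center.
Qed.

(** Testing the inclusion on two opposite corners compares the sides. *)
Lemma subcube_side (Q S : cube R d) : (0 < d)%N -> 0 <= side Q ->
  subcube Q S -> side Q <= side S.
Proof.
case: Q S => [x s] [y t] /= d0 s0 QS.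
have corner b : b = 1 \/ b = -1 ->
    cube_set (Cube x s) (\row_j (x ord0 j + b * (s / 2))).
  move=> hb i; rewrite /= mxE addrAC subrr add0r normrM.
  have -> : `|b| = 1 by case: hb => ->; rewrite ?normrN normr1.
  by rewrite mul1r ger0_norm// divr_ge0.
have := QS _ (corner 1 (or_introl erefl)) (Ordinal d0).
have := QS _ (corner (-1) (or_intror erefl)) (Ordinal d0).
by rewrite /= !mxE !ler_norml => /andP[h1 h2] /andP[h3 h4]; lra.
Qed.

Lemma closed_cube (Q : cube R d) : closed (cube_set Q : set 'rV[R]_d).
Proof.
have -> : (cube_set Q : set 'rV[R]_d) =
   \bigcap_(i in [set: 'I_d]) ((fun y : 'rV[R]_d => y ord0 i) @^-1`
      `[Defs.center Q ord0 i - side Q / 2, Defs.center Q ord0 i + side Q / 2]).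
  apply/seteqP; split=> y h i.
    move=> _; have := h i; rewrite /= in_itv/= ler_norml => /andP[? ?].
    by apply/andP; split; lra.
  have := h i I; rewrite /= in_itv/= ler_norml => /andP[? ?].
  by apply/andP; split; lra.
apply: closed_bigI => i _; apply: closed_comp.
  by move=> y _; exact: coord_continuous.
exact: interval_closed.
Qed.

Lemma compact_cube (Q : cube R d) : compact (cube_set Q : set 'rV[R]_d).
Proof.
have -> : (cube_set Q : set 'rV[R]_d) =
   [set y : 'rV[R]_d | forall i,
      `[Defs.center Q ord0 i - side Q / 2, Defs.center Q ord0 i + side Q / 2]%classic
        (y ord0 i)].
  apply/seteqP; split=> y h i; have := h i; rewrite /= in_itv/= ler_norml;
    by move=> /andP[? ?]; apply/andP; split; lra.
apply: (@rV_compact _ _ (fun i =>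
   `[Defs.center Q ord0 i - side Q / 2, Defs.center Q ord0 i + side Q / 2]%classic)).
by move=> i; exact: segment_compact.
Qed.

Lemma measurable_cube (Q : cube R d) : measurable (cube_set Q).
Proof.
rewrite -(setCK (cube_set Q)); apply: measurableC.
by apply: sub_gen_smallest; apply: closed_openC; exact: closed_cube.
Qed.

End CubeGeometry.

#[local] Hint Resolve measurable_cube : core.

Section Mass.
Context {R : realType} {d : nat} {mu : {measure set (Rd R d) -> \bar R}}.
Context (mufin : forall A : set 'rV[R]_d, compact A -> (mu A < +oo)%E).
Implicit Types (x y z : 'rV[R]_d) (r s t c : R) (f : Rd R d -> R).
Implicit Types (Q S : cube R d).

Lemma massE Q : mu (cube_set Q) = (mass mu Q)%:E.
Proof. by rewrite fineK// ge0_fin_numE//; exact/mufin/compact_cube. Qed.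

Lemma mass_ge0 Q : 0 <= mass mu Q.
Proof. exact: fine_ge0. Qed.

Lemma le_mass Q S : subcube Q S -> mass mu Q <= mass mu S.
Proof. by move=> QS; rewrite -lee_fin -!massE le_measure ?inE. Qed.

Lemma integrable_cube_cst Q c :
  mu.-integrable (cube_set Q) (cst c%:E : Rd R d -> \bar R).
Proof.
apply/integrableP; split; first exact: measurable_cst.
by rewrite integral_cst// massE -EFinM ltry.
Qed.

Context {f : Rd R d -> R} (fint : loc_integrable mu f).

Lemma integrable_osc Q c :
  mu.-integrable (cube_set Q) (fun x => (f x - c)%:E).
Proof.
rewrite (_ : (fun x => _) = ((EFin \o f) \- cst c%:E)%E)//.
apply: integrableB => //; first exact/(proj2 fint)/compact_cube.
exact: integrable_cube_cst.
Qed.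

Lemma integrable_norm_osc Q c :
  mu.-integrable (cube_set Q) (EFin \o (fun x => `|f x - c|)).
Proof. exact: (integrable_norm (integrable_osc Q c)). Qed.

Lemma EFin_osc Q c : (integral_on mu Q (fun x => `|f x - c|))%:E =
  (\int[mu]_(x in cube_set Q) `|f x - c|%:E)%E.
Proof.
rewrite /integral_on /Rintegral fineK//.
exact: integrable_fin_num (integrable_norm_osc Q c).
Qed.

Lemma osc_triangle Q b c :
  integral_on mu Q (fun x => `|f x - c|) <=
  integral_on mu Q (fun x => `|f x - b|) + `|b - c| * mass mu Q.
Proof.
have cint : mu.-integrable (cube_set Q) (EFin \o (cst `|b - c|)).
  exact: integrable_cube_cst.
rewrite /mass -Rintegral_cst// -RintegralD//; last exact: integrable_norm_osc.
apply: le_Rintegral => //; first exact: integrable_norm_osc.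
  exact: integrableD (integrable_norm_osc Q b) cint.
by move=> x _; rewrite -(subrKA b); exact: ler_normD.
Qed.

Lemma mean_osc Q c : 0 < mass mu Q ->
  `|mean mu Q f - c| <=
  (mass mu Q)^-1 * integral_on mu Q (fun x => `|f x - c|).
Proof.
move=> Q0; have -> : mean mu Q f - c =
    (mass mu Q)^-1 * integral_on mu Q (fun x => f x - c).
  rewrite /mean /integral_on RintegralB//; last 2 first.
  - exact/(proj2 fint)/compact_cube.
  - exact: integrable_cube_cst.
  by rewrite Rintegral_cst// -/(mass mu Q) mulrBr [c * _]mulrC mulKf ?gt_eqF.
rewrite normrM ger0_norm ?invr_ge0 ?mass_ge0//.
rewrite ler_pM2l ?invr_gt0//; apply: le_normr_Rintegral => //.
exact: integrable_osc.
Qed.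

Lemma mean_norm_le Q : 0 < mass mu Q ->
  `|mean mu Q f| <= (mass mu Q)^-1 * integral_on mu Q (fun x => `|f x|).
Proof.
move=> /(mean_osc 0); rewrite subr0 /integral_on.
by under eq_Rintegral do rewrite subr0.
Qed.

End Mass.

(** * The Besicovitch covering theorem for cubes *)

Section Besicovitch.
Context {R : realType} {d : nat}.
Implicit Types (x y : 'rV[R]_d) (s t l : R) (p q : 'rV[R]_d * R).
Implicit Types (L : seq ('rV[R]_d * R)) (E : set 'rV[R]_d).

(** The cube with center [p.1] and side [p.2]; unlike [cube], the type of [p]
    has a decidable equality, so that such pairs can be listed. *)
Definition pcube p : cube R d := Cube p.1 p.2.

(** The list is one that Besicovitch's greedy selection can produce: sides do
    not increase, and no center lies in an earlier cube. *)
Definition greedy L : bool :=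
  pairwise (fun p q => `[< q.2 <= p.2 /\ ~ cube_set (pcube p) q.1 >]) L.

(** Two cubes of a greedy list whose centers lie in the same orthant seen from
    a common point [y] cannot coexist: the larger would contain the center of
    the smaller. *)
Lemma greedy_overlap L y :
  greedy L -> (count (fun p => `[< cube_set (pcube p) y >]) L <= 2 ^ d)%N.
Proof.
move=> gL; pose orthant (p : 'rV[R]_d * R) : {ffun 'I_d -> bool} :=
  [ffun i => y ord0 i <= p.1 ord0 i].
rewrite -size_filter; set L' := seq.filter _ _.
have Ly p : p \in L' -> cube_set (pcube p) y.
  by rewrite mem_filter => /andP[/asboolP].
have : uniq (map orthant L').
  rewrite uniq_pairwise pairwise_map.
  have gL' : greedy L' by apply: subseq_pairwise gL; exact: filter_subseq.
  apply: (@sub_in_pairwise _ (mem L') _ _ _ L' _ gL'); last exact/allP.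
  move=> p q /Ly py /Ly qy /asboolP[qp pq] /=.
  apply/eqP => /ffunP opq; apply: pq => i.
  have := py i; have := qy i; have := opq i; rewrite /= !ffunE !ler_norml.
  have [? /esym ?|? /esym /negbT] := leP (y ord0 i) (p.1 ord0 i).
    by move=> /andP[? ?] /andP[? ?]; apply/andP; split; lra.
  by rewrite -ltNge => ? /andP[? ?] /andP[? ?]; apply/andP; split; lra.
move=> /card_uniqP; rewrite size_map => <-.
by apply: leq_trans (max_card _) _; rewrite card_ffun card_bool card_ord.
Qed.

(** One stage of the selection, at the scale [s]: the colours are visited in
    turn, and for each a center is added if some point of that colour is still
    uncovered; its cube then covers all points of that colour. *)
Lemma greedy_extend (V : eqType) (colour : 'rV[R]_d -> V) (vs : seq V) E s L :
  greedy L -> (forall p, p \in L -> s <= p.2) ->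
  (forall x y, E x -> E y -> colour x = colour y -> cube_set (Cube x s) y) ->
  exists L', [/\ greedy L', {subset L <= L'},
    forall p, p \in L' -> p \in L \/ E p.1 /\ p.2 = s,
    forall x, E x -> colour x \in vs ->
      exists2 p, p \in L' & cube_set (pcube p) x
    & (size L' <= size L + size vs)%N].
Proof.
move=> gL Ls close; elim: vs => [|v vs [L1 [gL1 LL1 L1E L1c szL1]]].
  by exists L; split=> //; [move=> p; left | rewrite addn0].
have [[x [Ex xv xL1]]|nx] := pselect (exists x, [/\ E x, colour x = v
    & forall p, p \in L1 -> ~ cube_set (pcube p) x]); last first.
  exists L1; split=> //; last by rewrite /= addnS ltnW.
  move=> x Ex; rewrite in_cons => /predU1P[xv|]; last exact: L1c.
  apply: contrapT => xL1; apply: nx; exists x; split=> // p pL1 px.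
  by apply: xL1; exists p.
exists (rcons L1 (x, s)); split.
- rewrite /greedy pairwise_rcons; apply/andP; split=> //; apply/allP => p pL1.
  apply/asboolP; split; last exact: xL1.
  by have [/Ls|[_ ->]] := L1E _ pL1.
- by move=> p /LL1 pL1; rewrite mem_rcons in_cons pL1 orbT.
- move=> p; rewrite mem_rcons in_cons => /predU1P[->|/L1E//].
  by right.
- move=> y Ey; rewrite in_cons => /predU1P[yv|yvs].
    exists (x, s); first by rewrite mem_rcons mem_head.
    by apply: close => //; rewrite xv yv.
  have [p pL1 py] := L1c _ Ey yvs; exists p => //.
  by rewrite mem_rcons in_cons pL1 orbT.
- by rewrite size_rcons /= addnS.
Qed.

(** The colour of a point is the cell that contains it in a grid of mesh
    [s / 2]. *)
Lemma grid_colouring (Q : cube R d) s : 0 < s -> 0 < side Q ->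
  exists (m : nat) (colour : 'rV[R]_d -> {ffun 'I_d -> 'I_m.+1}),
    m%:R <= 2 * side Q / s /\
    forall x y, cube_set Q x -> cube_set Q y -> colour x = colour y ->
      cube_set (Cube x s) y.
Proof.
case: Q => c l /= s0 l0.
have ls0 : 0 <= 2 * l / s by rewrite divr_ge0 ?mulr_ge0 ?ltW.
pose pos x i := (x ord0 i - c ord0 i + l / 2) / (s / 2).
have posP x : cube_set (Cube c l) x -> forall i, 0 <= pos x i <= 2 * l / s.
  move=> xQ i; have := xQ i; rewrite /= ler_norml => /andP[h1 h2].
  apply/andP; split; first by rewrite divr_ge0//; lra.
  rewrite /pos ler_pdivrMr ?divr_gt0//.
  have -> : 2 * l / s * (s / 2) = l by field; rewrite gt_eqF.
  by lra.
exists (Num.truncn (2 * l / s)).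
exists (fun x => [ffun i => inord (Num.truncn (pos x i))]).
have posT x : cube_set (Cube c l) x -> forall i,
    (Num.truncn (pos x i) < (Num.truncn (2 * l / s)).+1)%N.
  move=> xQ i; rewrite ltnS; have /andP[? ?] := posP x xQ i.
  exact: le_truncn.
split; first by have /andP[] := truncn_itv ls0.
move=> x y xQ yQ /ffunP xy i.
have := xy i; rewrite !ffunE => /(congr1 (@nat_of_ord _)).
rewrite !inordK ?posT// => txy.
have /andP[x0 _] := posP x xQ i; have /andP[y0 _] := posP y yQ i.
have /andP[] := truncn_itv x0; have /andP[] := truncn_itv y0.
rewrite txy -!(natr1 (Num.truncn (pos y i))).
set t := (Num.truncn _)%:R => h1 h2 h3 h4.
have : `|pos y i - pos x i| <= 1.
  by rewrite ler_norml; apply/andP; split; lra.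
have -> : pos y i - pos x i = (y ord0 i - x ord0 i) / (s / 2).
  by rewrite /pos; field; rewrite gt_eqF.
have s20 : 0 < s / 2 by rewrite divr_gt0.
rewrite normrM normfV (gtr0_norm s20).
by rewrite ler_pdivrMr// mul1r.
Qed.

(** Stages are run from the largest scale to the smallest.  Finitely many scales
    and a bounded set of centers make the selection finite. *)
Lemma besicovitch (Q : cube R d) (E : nat -> set 'rV[R]_d) (r : nat -> R) K :
  0 < side Q -> (forall k, E k `<=` cube_set Q) ->
  (forall k, 0 < r k) -> (forall k, r k.+1 <= r k) ->
  exists L, [/\ greedy L,
    forall p, p \in L -> exists2 k, E k p.1 & p.2 = r k
    & forall k x, (k <= K)%N -> E k x ->
        exists2 p, p \in L & cube_set (pcube p) x].
Proof.
move=> Q0 EQ r0 rS.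
suff [L [gL LE LK]] : exists L, [/\ greedy L,
    forall p, p \in L -> exists2 k, E k p.1 & p.2 = r k /\ (k < K.+1)%N
    & forall k x, (k < K.+1)%N -> E k x ->
        exists2 p, p \in L & cube_set (pcube p) x].
  by exists L; split=> // p /LE[k Ek [pk _]]; exists k.
elim: K.+1 => [|{}K [L [gL LE LK]]]; first by exists [::].
have [m [colour [_ close]]] := grid_colouring (r0 K) Q0.
have LrK p : p \in L -> r K <= p.2.
  move=> /LE[k _ [-> kK]].
  by apply: (nonincreasing_seqP _).1 (ltnW kK) => //; exact/nonincreasing_seqP.
have [L' [gL' LL' L'E L'c _]] := greedy_extend (enum {ffun 'I_d -> 'I_m.+1})
  gL LrK (fun x y Ex Ey => close x y (EQ K x Ex) (EQ K y Ey)).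
exists L'; split=> //.
- move=> p /L'E[/LE[k Ek [-> kK]]|[EK ->]]; last by exists K.
  by exists k => //; split => //; exact: ltnW.
- move=> k x; rewrite ltnS leq_eqVlt => /predU1P[->|kK] Ex.
    by apply: L'c => //; rewrite mem_enum inE.
  by have [p /LL' pL' px] := LK _ _ kK Ex; exists p.
Qed.

End Besicovitch.

(** * Small doubling cubes cover almost everything *)

Lemma geometric_bound_le0 {R : realType} (a A rho : R) :
  0 <= rho < 1 -> (forall k, a <= A * rho ^+ k) -> a <= 0.
Proof.
move=> /andP[r0 r1] aA.
have rho1 : `|rho| < 1 by rewrite ger0_norm.
have cv := @cvg_geometric _ A _ rho1.
rewrite -(cvg_lim (@Rhausdorff R) cv).
apply: limr_ge; first by apply/cvg_ex; exists 0.
by apply: nearW => k; exact: aA.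
Qed.

Section Covering.
Context {R : realType} {d : nat} {mu : {measure set (Rd R d) -> \bar R}}.
Context (mufin : forall A : set 'rV[R]_d, compact A -> (mu A < +oo)%E).
Implicit Types (L : seq ('rV[R]_d * R)) (Q S : cube R d) (s t : R).

Definition cube_union L : set (Rd R d) :=
  \big[setU/set0]_(p <- L) cube_set (pcube p).

Lemma measurable_cube_union L : measurable (cube_union L).
Proof. by apply: bigsetU_measurable. Qed.

#[local] Hint Resolve measurable_cube_union : core.

Lemma cube_unionP L x :
  cube_union L x <-> exists2 p, p \in L & cube_set (pcube p) x.
Proof.
rewrite /cube_union -bigcup_seq; split=> [[p pL px]|[p pL px]]; by exists p.
Qed.

Lemma integral_union_le L (g : Rd R d -> \bar R) :
  measurable_fun [set: Rd R d] g -> (forall x, (0 <= g x)%E) ->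
  (\int[mu]_(x in cube_union L) g x <=
   \sum_(p <- L) \int[mu]_(x in cube_set (pcube p)) g x)%E.
Proof.
move=> mg g0; elim: L => [|p L IH].
  by rewrite /cube_union !big_nil integral_set0.
rewrite /cube_union !big_cons -/(cube_union L).
have -> : cube_set (pcube p) `|` cube_union L =
    cube_set (pcube p) `|` (cube_union L `\` cube_set (pcube p)).
  by rewrite setUDr setDv setD0.
rewrite ge0_integral_setU//; last 3 first.
- exact: measurableD.
- exact: measurable_funTS.
- by apply/disj_setPS => x [px []].
apply: leeD => //; apply: le_trans IH; apply: ge0_subset_integral => //.
- exact: measurableD.
- exact: measurable_funTS.
Qed.

Lemma sum_mass_greedy L S : greedy L ->
  (forall p, p \in L -> subcube (pcube p) S) ->
  \sum_(p <- L) mass mu (pcube p) <= (2 ^ d)%:R * mass mu S.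
Proof.
move=> gL LS; rewrite -lee_fin -sumEFin EFinM -(massE mufin S).
have -> : (\sum_(p <- L) (mass mu (pcube p))%:E =
    \sum_(p <- L) \int[mu]_(x in cube_set S) (\1_(cube_set (pcube p)) x)%:E)%E.
  apply: eq_big_seq => p pL; rewrite integral_indic// setIidl ?(massE mufin)//.
  exact: LS.
rewrite -ge0_integral_sum//; last first.
  by move=> p; apply/measurable_EFinP; exact: measurable_indic.
rewrite -(integral_cst mu (measurable_cube S)).
apply: ge0_le_integral => //.
- by move=> x _; apply: sume_ge0 => p _; rewrite lee_fin.
- apply: emeasurable_sum => p; apply/measurable_EFinP.
  exact: measurable_indic.
move=> x _; rewrite sumEFin lee_fin.
apply: le_trans (_ : (count (fun p => `[< cube_set (pcube p) x >]) L)%:R <= _).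
  rewrite -sum1_count natr_sum [leRHS]big_mkcond/=.
  apply: ler_sum => p _; rewrite indicE.
  by case: asboolP => px; rewrite ?(mem_set px) ?(memNset px).
by rewrite ler_nat; exact: greedy_overlap.
Qed.

(** Around a point where no cube of the chain is doubling, masses decay like
    [beta ^- k]; the [O(alpha ^ (k d))] grid cells of that scale that meet the
    exceptional set then have total mass [O((alpha ^ d / beta) ^ k)]. *)
Lemma nondoubling_null (alpha beta : R) Q s :
  1 < alpha -> alpha ^+ d < beta -> 0 < side Q -> 0 < s ->
  exists N : set (Rd R d), [/\ measurable N, mu N = 0%E &
    forall x, cube_set Q x -> ~ N x ->
      exists k, doubling mu alpha beta (Cube x (alpha ^- k * s))].
Proof.
move=> alpha1 ab Q0 s0; have alpha0 : 0 < alpha by apply: lt_trans alpha1.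
have beta0 : 0 < beta by apply: le_lt_trans ab; rewrite exprn_ge0// ltW.
pose bad : set 'rV[R]_d := [set x | cube_set Q x /\
  forall k, ~ doubling mu alpha beta (Cube x (alpha ^- k * s))].
pose M := mass mu (Cube (Defs.center Q) (side Q + s)).
have decay x k : bad x -> mass mu (Cube x (alpha ^- k * s)) <= beta ^- k * M.
  move=> [xQ xbad]; elim: k => [|k IH].
    rewrite expr0 invr1 !mul1r; apply: (le_mass mufin).
    by case: (Q) xQ => c l xQ; exact: cube_subset xQ _.
  have /negP := xbad k.+1; rewrite -ltNge /dilate /= => lt.
  rewrite [beta ^+ _]exprS invfM -mulrA ler_pdivlMl//; apply/ltW/(lt_le_trans lt).
  apply: le_trans IH; rewrite exprS invfM -!mulrA mulVKf ?gt_eqF//.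
have sk0 k : 0 < alpha ^- k * s by rewrite mulr_gt0// invr_gt0 exprn_gt0.
pose A := (2 * side Q / s + 1) ^+ d * M.
pose rho := alpha ^+ d / beta.
have cover k : exists L, bad `<=` cube_union L /\
    (mu (cube_union L) <= (A * rho ^+ k)%:E)%E.
  have [m [colour [ms close]]] := grid_colouring (sk0 k) Q0.
  have [L [_ _ LE Lc szL]] := @greedy_extend _ _ _ colour
    (enum {ffun 'I_d -> 'I_m.+1}) bad (alpha ^- k * s) [::] isT
    (fun p (H : p \in [::]) => False_ind _ (elimF idP (in_nil p) H))
    (fun x y bx byy => close x y bx.1 byy.1).
  exists L; split.
    by move=> x bx; apply/cube_unionP; apply: Lc => //; rewrite mem_enum inE.
  have -> : mu (cube_union L) = (\int[mu]_(x in cube_union L) 1)%E.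
    by rewrite integral_cst ?mul1e.
  apply: (le_trans (integral_union_le _ _ _)) => //.
  under eq_bigr do rewrite integral_cst// mul1e (massE mufin).
  rewrite sumEFin lee_fin.
  apply: le_trans (_ : \sum_(p <- L) beta ^- k * M <= _).
    rewrite big_seq [leRHS]big_seq; apply: ler_sum => p pL.
    by have [//|[bp p2]] := LE p pL; rewrite /pcube p2; exact: decay.
  rewrite big_const_seq count_predT iter_addr_0 -[leLHS]mulr_natl.
  have M0 : 0 <= M by exact: mass_ge0.
  have -> : A * rho ^+ k =
      ((2 * side Q / s + 1) * alpha ^+ k) ^+ d * (beta ^- k * M).
    by rewrite /A /rho expr_div_n -exprM mulnC exprM exprMn mulrACA [M * _]mulrC.
  apply: ler_wpM2r; first by rewrite mulr_ge0// invr_ge0 exprn_ge0// ltW.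
  apply: le_trans (_ : (m.+1 ^ d)%:R <= _).
    rewrite ler_nat; apply: (leq_trans szL).
    by rewrite -cardE card_ffun !card_ord.
  rewrite natrX; apply: lerXn2r; rewrite ?nnegrE//.
    by rewrite mulr_ge0 ?exprn_ge0 ?addr_ge0 ?divr_ge0 ?mulr_ge0// ltW.
  rewrite -natr1 mulrDl mul1r; apply: lerD; last exact: exprn_ege1 (ltW _).
  apply: le_trans ms _; rewrite invfM invrK.
  by rewrite mulrA mulrAC.
have [L HL] := choice cover.
have mN : measurable (\bigcap_k cube_union (L k)) by exact: bigcap_measurable.
exists (\bigcap_k cube_union (L k)); split=> //.
  have muN k : (mu (\bigcap_k cube_union (L k)) <= (A * rho ^+ k)%:E)%E.
    apply: le_trans (HL k).2; apply: le_measure; rewrite ?inE//.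
    exact: bigcap_inf.
  have fN : mu (\bigcap_k cube_union (L k)) \is a fin_num.
    by rewrite ge0_fin_numE//; apply: le_lt_trans (muN 0%N) (ltry _).
  apply/eqP; rewrite eq_le measure_ge0 andbT -(fineK fN) lee_fin.
  apply: (@geometric_bound_le0 _ _ A rho) => [|k].
    rewrite divr_ge0 ?exprn_ge0 ?ltW//= /rho.
    by rewrite ltr_pdivrMr// mul1r.
  by rewrite -lee_fin fineK.
move=> x xQ; apply: contra_notP => /forallNP nd k _.
by apply: (HL k).1.
Qed.

(** Almost every point of [Q] is the center of a first doubling cube in the
    chain of sides [alpha ^- k * s].  Besicovitch's theorem selects some of
    these cubes, finitely many for each truncation of the chain; they lie in
    the enlarged cube, overlap at most [2 ^ d] times, and exhaust [Q] up to a
    null set, so that a bound on each of them passes to [Q]. *)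
Lemma osc_covering (alpha beta : R) (f : Rd R d -> R) (c B s t : R) Q :
  1 < alpha -> alpha ^+ d < beta -> loc_integrable mu f ->
  0 < side Q -> 0 < s -> side Q + s <= t -> 0 <= B ->
  (forall x k, cube_set Q x ->
     doubling mu alpha beta (Cube x (alpha ^- k * s)) ->
     (forall j, (j < k)%N ->
        ~ doubling mu alpha beta (Cube x (alpha ^- j * s))) ->
     integral_on mu (Cube x (alpha ^- k * s)) (fun y => `|f y - c|) <=
     B * mass mu (Cube x (alpha ^- k * s))) ->
  integral_on mu Q (fun y => `|f y - c|) <=
  (2 ^ d)%:R * B * mass mu (Cube (Defs.center Q) t).
Proof.
move=> alpha1 ab fint Q0 s0 st B0 HB.
have alpha0 : 0 < alpha by apply: lt_trans alpha1.
pose g (y : Rd R d) : \bar R := `|f y - c|%:E.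
have mg : measurable_fun [set: Rd R d] g.
  apply/measurable_EFinP; apply: measurableT_comp => //.
  by apply: measurable_funB => //; exact: fint.1.
have g0 x : (0 <= g x)%E by rewrite lee_fin.
have [N [mN N0 QN]] := nondoubling_null alpha1 ab Q0 s0.
pose r k := alpha ^- k * s.
pose E k : set 'rV[R]_d := [set x | [/\ cube_set Q x,
  doubling mu alpha beta (Cube x (r k)) &
  forall j, (j < k)%N -> ~ doubling mu alpha beta (Cube x (r j))]].
have r0 k : 0 < r k by rewrite mulr_gt0// invr_gt0 exprn_gt0.
have rS k : r k.+1 <= r k.
  rewrite /r exprS invfM ler_wpM2r ?(ltW s0)// ler_piMl ?invr_ge0 ?exprn_ge0 ?ltW//.
  by rewrite invf_lt1.
have rs k : r k <= s.
  by rewrite /r ler_piMl ?(ltW s0)// invf_le1 ?exprn_gt0// exprn_ege1 ?ltW.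
set S := Cube (Defs.center Q) t.
pose D := (2 ^ d)%:R * B * mass mu S.
(* The selections for different [K] are not nested, hence the sets [V K] below. *)
have cover K : exists L, (forall k, (k <= K)%N -> E k `<=` cube_union L) /\
    (\int[mu]_(y in cube_union L) g y <= D%:E)%E.
  have EQ k : E k `<=` cube_set Q by move=> x [].
  have [L [gL LE Lc]] := @besicovitch _ _ Q E r K Q0 EQ r0 rS.
  exists L; split; first by move=> k kK x Ex; apply/cube_unionP; exact: Lc kK Ex.
  apply: (le_trans (integral_union_le _ _ _)) => //.
  have -> : (\sum_(p <- L) \int[mu]_(x in cube_set (pcube p)) g x =
     \sum_(p <- L) (integral_on mu (pcube p) (fun y => `|f y - c|))%:E)%E.
    by apply: eq_bigr => p _; rewrite (EFin_osc mufin fint).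
  rewrite sumEFin lee_fin.
  apply: le_trans (_ : B * \sum_(p <- L) mass mu (pcube p) <= _).
    rewrite mulr_sumr big_seq [leRHS]big_seq; apply: ler_sum => p pL.
    by have [k [pQ dk nk] p2] := LE p pL; rewrite /pcube p2; exact: HB.
  rewrite /D [_ * B]mulrC -mulrA ler_wpM2l//.
  apply: sum_mass_greedy => // p /LE[k [pQ _ _] p2].
  have QE : Q = Cube (Defs.center Q) (side Q) by case: (Q).
  rewrite QE in pQ; apply: cube_subset pQ _.
  by rewrite p2; apply: le_trans st; rewrite lerD2l.
have [L HL] := choice cover.
pose V K : set (Rd R d) := \bigcap_(k in [set k | (K <= k)%N]) cube_union (L k).
have mV K : measurable (V K).
  by apply: bigcap_measurable => //; exists K => /=.
have VS : nondecreasing_seq V.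
  move=> K K' KK'; apply/subsetPset => x Vx k /= K'k.
  by apply: Vx; exact: leq_trans K'k.
have QV : cube_set Q `\` N `<=` \bigcup_K V K.
  move=> x [xQ xN]; have [k0 dk0] := QN x xQ xN.
  have ex : exists k, `[< doubling mu alpha beta (Cube x (r k)) >].
    by exists k0; exact/asboolP.
  case: (ex_minnP ex) => k /asboolP dk mink; exists k => // j /= kj.
  apply: (HL j).1 kj _ _; split=> // i ik /asboolP/mink.
  by rewrite leqNgt ik.
have intV : (\int[mu]_(x in \bigcup_K V K) g x <= D%:E)%E.
  have cv := @ge0_nondecreasing_set_cvg_integral _ _ _ V g mu VS mV
     (fun K => measurable_funTS mg) (fun K x _ => g0 x).
  rewrite -(cvg_lim _ cv)//; apply: lime_le.
    by apply/cvg_ex; eexists; exact: cv.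
  apply: nearW => K; apply: le_trans (HL K).2.
  apply: ge0_subset_integral => //; first exact: measurable_funTS.
  by move=> x; apply; exact: leqnn.
rewrite -lee_fin (EFin_osc mufin fint).
rewrite (@ge0_negligible_integral _ _ _ _ _ N)//; last exact: measurable_funTS.
apply: le_trans intV; apply: ge0_subset_integral => //.
- exact: measurableD.
- exact: bigcup_measurable.
- exact: measurable_funTS.
Qed.

End Covering.

(** * Sums of densities over dyadic scales *)

Lemma exists_expr_ge {R : realType} (a s t : R) :
  1 < a -> 0 < s -> exists k, t < a ^+ k * s.
Proof.
move=> a1 s0; apply: contrapT => /forallNP small.
have a0 : 0 < a by apply: lt_trans a1.
suff : s <= 0 by rewrite leNgt s0.
apply: (@geometric_bound_le0 _ _ t a^-1) => [|k].
  by rewrite invr_ge0 ltW//= invf_lt1.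
rewrite exprVn ler_pdivlMr ?exprn_gt0// mulrC leNgt.
exact/negP/small.
Qed.

Section Scales.
Context {R : realType} {d : nat} {mu : {measure set (Rd R d) -> \bar R}}.
Context {n C0 alpha beta : R}.
Context (mufin : forall A : set 'rV[R]_d, compact A -> (mu A < +oo)%E).
Context (n0 : 0 < n) (C00 : 0 < C0) (mugrowth : growth n C0 mu).
Context (alpha1 : 1 < alpha) (alphan_lt : alpha `^ n < beta).
Implicit Types (x y z : 'rV[R]_d) (r s t u B : R).

Let alpha0 : 0 < alpha. Proof. exact: lt_trans alpha1. Qed.
Let beta0 : 0 < beta. Proof. by apply: le_lt_trans alphan_lt; exact: powR_ge0. Qed.
Let alpha_dyadic : exists M, alpha < 2 ^+ M.
Proof.
have [M aM] := exists_expr_ge alpha (ltr1n R 2) ltr01.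
by exists M; rewrite mulr1 in aM.
Qed.

Definition density x r : R := mass mu (Cube x r) / r `^ n.

(** A bound on the densities summed over any dyadic progression of scales in
    [[s, t]].  Unlike [Kcoef], whose progression starts at the side of a given
    cube, this behaves well under concatenation of intervals and change of
    center. *)
Definition density_sum_le x s t B : Prop := forall r N, s <= r ->
  (forall k, (k < N)%N -> 2 ^+ k * r <= t) ->
  \sum_(k < N) density x (2 ^+ k * r) <= B.

Lemma density_ge0 x r : 0 <= density x r.
Proof. by rewrite divr_ge0 ?powR_ge0// mass_ge0. Qed.

Lemma mass_growth x r : 0 < r -> mass mu (Cube x r) <= C0 * r `^ n.
Proof. by move=> r0; rewrite -lee_fin -(massE mufin); exact: mugrowth. Qed.

Lemma density_le x r : 0 < r -> density x r <= C0.
Proof. by move=> r0; rewrite ler_pdivrMr ?powR_gt0//; exact: mass_growth. Qed.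

Lemma density_le_double x y r u : 0 < r -> 0 < u ->
  subcube (Cube x r) (Cube y u) -> u <= 2 * r ->
  density x r <= 2 `^ n * density y u.
Proof.
move=> r0 u0 sub u2; rewrite /density mulrA [2 `^ n * _]mulrC.
rewrite ler_pdivrMr ?powR_gt0// mulrAC ler_pdivlMr ?powR_gt0// -mulrA.
apply: ler_pM; rewrite ?mass_ge0 ?powR_ge0//; first exact: le_mass.
rewrite -powRM ?(ltW r0)//.
by apply: ge0_ler_powR; rewrite ?nnegrE ?mulr_ge0 ?(ltW n0) ?(ltW u0) ?(ltW r0).
Qed.

Lemma density_sum_leW x s t s' t' B B' :
  density_sum_le x s t B -> s <= s' -> t' <= t -> B <= B' ->
  density_sum_le x s' t' B'.
Proof.
move=> h ss tt BB r N sr rt; apply: le_trans BB; apply: h.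
  exact: le_trans sr.
by move=> k /rt h; exact: le_trans tt.
Qed.

Lemma density_sum_le_cat x s t u B1 B2 :
  density_sum_le x s t B1 -> density_sum_le x t u B2 ->
  density_sum_le x s u (B1 + B2).
Proof.
move=> h1 h2 r N sr ru.
have [/forallP small|] := boolP [forall k : 'I_N, 2 ^+ k * r <= t].
  rewrite -[leLHS]addr0; apply: lerD.
    by apply: h1 => // k kN; exact: small (Ordinal kN).
  by have := h2 t 0%N (lexx t); rewrite big_ord0; apply.
rewrite negb_forall => /existsP[k0]; rewrite -ltNge => k0t.
have ex : exists k, t < 2 ^+ k * r by exists k0.
case: (ex_minnP ex) => m tm mmin.
have mN : (m <= N)%N by apply: leq_trans (mmin _ k0t) (ltnW (ltn_ord k0)).
rewrite -(big_mkord xpredT (fun k => density x (2 ^+ k * r))).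
rewrite (big_cat_nat _ mN)//=; apply: lerD.
  rewrite big_mkord; apply: h1 => // k km.
  by rewrite leNgt; apply/negP => /mmin; rewrite leqNgt km.
rewrite -{1}[m]add0n big_addn big_mkord.
under eq_bigr do rewrite addnC exprD -mulrA mulrCA.
apply: h2; first exact: ltW.
by move=> k kN; rewrite mulrCA mulrA -exprD; apply: ru; rewrite -ltn_subRL.
Qed.

Lemma density_sum_le_local x s t M B : 0 < s -> t <= 2 ^+ M * s ->
  (forall r, s <= r -> r <= t -> density x r <= B) -> 0 <= B ->
  density_sum_le x s t (M.+1%:R * B).
Proof.
move=> s0 tM dB B0 r N sr rt.
have r0 : 0 < r by exact: lt_le_trans sr.
have NM : (N <= M.+1)%N.
  case: N rt => // N rt; have := rt N (ltnSn N) => h.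
  have : 2 ^+ N * r <= 2 ^+ M * r.
    by apply: (le_trans h); apply: (le_trans tM); rewrite ler_pM2l// exprn_gt0.
  by rewrite ler_pM2r// ler_eXn2l// ltr1n.
apply: le_trans (_ : \sum_(k < N) B <= _).
  apply: ler_sum => k _; apply: dB; last exact: rt.
  by apply: (le_trans sr); rewrite ler_peMl ?(ltW r0)// exprn_ege1// ler1n.
rewrite sumr_const card_ord -[leLHS]mulr_natl ler_wpM2r//.
by rewrite ler_nat.
Qed.

Lemma density_sum_le_growth x s t M : 0 < s -> t <= 2 ^+ M * s ->
  density_sum_le x s t (M.+1%:R * C0).
Proof.
move=> s0 tM; apply: density_sum_le_local => //; last exact: ltW.
by move=> r sr _; apply: density_le; exact: lt_le_trans sr.
Qed.

Lemma density_sum_le_twice x t : 0 < t ->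
  density_sum_le x t (2 * t) (2 * C0).
Proof.
by move=> t0; apply: (@density_sum_le_growth x t (2 * t) 1%N) => //; rewrite expr1.
Qed.

(** From the scale [s] on, the cube around [y] of twice the side contains the
    cube around [x], so that densities are lost only up to the factor
    [2 `^ n]. *)
Lemma density_sum_le_center x y s t B : 0 < s ->
  cube_set (Cube y s) x -> density_sum_le y s t B ->
  density_sum_le x s t (2 `^ n * (B + 2 * C0)).
Proof.
move=> s0 xy yB r N sr rt.
have [t0|t0] := ltP t s.
  case: N rt => [_|N rt].
    rewrite big_ord0 mulr_ge0 ?powR_ge0// addr_ge0 ?mulr_ge0 ?(ltW C00)//.
    by have := yB s 0%N (lexx s); rewrite big_ord0; apply.
  have := rt 0%N isT; rewrite expr0 mul1r => rt0.
  by have := lt_le_trans t0 sr; rewrite ltNge rt0.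
have r0 : 0 < r by exact: lt_le_trans sr.
have yB2 : density_sum_le y s (2 * t) (B + 2 * C0).
  apply: density_sum_le_cat yB _; apply: density_sum_le_twice.
  exact: lt_le_trans t0.
apply: le_trans (_ : \sum_(k < N) 2 `^ n * density y (2 ^+ k * (2 * r)) <= _).
  apply: ler_sum => k _; have k1 : 1 <= 2 ^+ k :> R by rewrite exprn_ege1// ler1n.
  have kr : r <= 2 ^+ k * r by rewrite ler_peMl ?(ltW r0).
  apply: density_le_double.
  - by rewrite mulr_gt0// exprn_gt0.
  - by rewrite !mulr_gt0// exprn_gt0.
    apply: cube_subset xy _; rewrite mulrCA.
    by have := le_trans sr kr; lra.
  by rewrite mulrCA.
rewrite -mulr_sumr ler_wpM2l ?powR_ge0//; apply: yB2.
  by lra.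
by move=> k kN; rewrite mulrCA ler_pM2l//; exact: rt.
Qed.

(** * Chains of dilations without doubling cubes *)

Lemma nondoubling_mass x s m :
  (forall j, (j < m)%N -> ~ doubling mu alpha beta (Cube x (alpha ^+ j * s))) ->
  beta ^+ m * mass mu (Cube x s) <= mass mu (Cube x (alpha ^+ m * s)).
Proof.
elim: m => [_|m IH nd]; first by rewrite !expr0 !mul1r.
have /negP := nd m (ltnSn m); rewrite -ltNge /dilate/= mulrA -exprS => /ltW.
apply: le_trans; rewrite exprS -mulrA ler_pM2l//; apply: IH => j jm.
by apply: nd; exact: ltnW.
Qed.

Let rho := alpha `^ n / beta.

Let rho_itv : 0 <= rho < 1.
Proof. by rewrite /rho divr_ge0 ?powR_ge0 ?(ltW beta0)//= ltr_pdivrMr// mul1r. Qed.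

Let powR_alphaX m s : 0 < s -> (alpha ^+ m * s) `^ n = (alpha `^ n) ^+ m * s `^ n.
Proof.
move=> s0; rewrite powRM ?exprn_ge0 ?(ltW alpha0) ?(ltW s0)//; congr (_ * _).
by rewrite -!powR_mulrn ?(ltW alpha0) ?powR_ge0// -!powRrM mulrC.
Qed.

Lemma exists_doubling x s : 0 < s -> 0 < mass mu (Cube x s) ->
  exists m, doubling mu alpha beta (Cube x (alpha ^+ m * s)).
Proof.
move=> s0 m0; apply: contrapT => /forallNP nd.
suff : mass mu (Cube x s) <= 0 by rewrite leNgt m0.
apply: (@geometric_bound_le0 _ _ (C0 * s `^ n) rho) => // k.
rewrite /rho expr_div_n mulrA ler_pdivlMr ?exprn_gt0// mulrC.
apply: (le_trans (@nondoubling_mass x s k (fun j _ => nd j))).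
apply: le_trans (mass_growth _ _) _; first by rewrite mulr_gt0 ?exprn_gt0.
by rewrite powR_alphaX// -mulrA [s `^ n * _]mulrC.
Qed.

(** Along a chain without doubling cubes the densities grow geometrically, with
    ratio [beta / alpha `^ n > 1] and last value at most [C0]. *)
Lemma nondoubling_density_sum : exists2 c, 0 <= c & forall x s m, 0 < s ->
  (forall j, (j < m)%N -> ~ doubling mu alpha beta (Cube x (alpha ^+ j * s))) ->
  density_sum_le x s (alpha ^+ m * s) c.
Proof.
have [M aM] := alpha_dyadic; have /andP[rho0 rho1] := rho_itv.
pose c1 := M.+1%:R * (C0 * alpha `^ n).
have c10 : 0 <= c1 by rewrite !mulr_ge0 ?powR_ge0// ltW.
exists (C0 + c1 / (1 - rho)).
  by rewrite addr_ge0 ?divr_ge0 ?(ltW C00)// subr_ge0 ltW.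
move=> x s m s0 nd.
suff H : density_sum_le x s (alpha ^+ m * s) (C0 + c1 * \sum_(j < m) rho ^+ j).
  apply: density_sum_leW H _ _ _ => //; rewrite lerD2l ler_wpM2l//.
  rewrite -[leRHS]mul1r ler_pdivlMr ?subr_gt0//.
  rewrite mulrC -[leLHS]opprK -mulNr opprB -subrX1 opprB.
  by rewrite gerBl exprn_ge0.
elim: m s s0 nd => [|m IH] s s0 nd.
  rewrite big_ord0 mulr0 addr0 expr0 mul1r -[C0]mul1r.
  by apply: (@density_sum_le_growth x s s 0%N) => //; rewrite expr0 mul1r.
have as0 : 0 < alpha * s by rewrite mulr_gt0.
have nd' j : (j < m)%N ->
    ~ doubling mu alpha beta (Cube x (alpha ^+ j * (alpha * s))).
  by move=> jm; rewrite mulrA -exprSr; exact: nd.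
rewrite big_ord_recr/= exprSr -mulrA.
have -> : C0 + c1 * (\sum_(i < m) rho ^+ i + rho ^+ m) =
  c1 * rho ^+ m + (C0 + c1 * \sum_(i < m) rho ^+ i) by ring.
apply: density_sum_le_cat (IH _ as0 nd').
rewrite /c1 -mulrA; apply: density_sum_le_local => //.
- by rewrite ler_pM2r// ltW.
- move=> r sr ras; have r0 : 0 < r by exact: lt_le_trans sr.
  rewrite ler_pdivrMr ?powR_gt0//.
  apply: le_trans (_ : mass mu (Cube x (alpha * s)) <= _).
    by apply: le_mass => //; exact: cube_subset_concentric.
  apply: le_trans (_ : C0 * alpha `^ n * rho ^+ m * s `^ n <= _).
    rewrite /rho expr_div_n -(ler_pM2l (exprn_gt0 m beta0)).
    apply: (le_trans (nondoubling_mass nd')).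
    apply: le_trans (mass_growth _ _) _; first by rewrite mulr_gt0 ?exprn_gt0.
    rewrite powR_alphaX// powRM ?(ltW alpha0) ?(ltW s0)//.
    have bm : beta ^+ m != 0 by rewrite gt_eqF ?exprn_gt0.
    by rewrite le_eqVlt; apply/orP; left; apply/eqP; field.
  apply: ler_wpM2l; first by rewrite !mulr_ge0 ?exprn_ge0 ?powR_ge0 ?(ltW C00).
  by apply: ge0_ler_powR; rewrite ?nnegrE ?(ltW n0) ?(ltW s0) ?(ltW r0).
- by rewrite !mulr_ge0 ?exprn_ge0 ?powR_ge0 ?(ltW C00).
Qed.

(** Indexed from the top, as the chains of [osc_covering] are.  Nothing is known
    of the lowest cube, so that one step of the chain is left to the growth
    condition. *)
Lemma nondoubling_density_sum_down : exists2 c, 0 <= c & forall x t k, 0 < t ->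
  (forall j, (j < k)%N -> ~ doubling mu alpha beta (Cube x (alpha ^- j * t))) ->
  density_sum_le x (alpha ^- k * t) t c.
Proof.
have [c c0 H] := nondoubling_density_sum.
have [M aM] := alpha_dyadic.
exists (M.+1%:R * C0 + c); first by rewrite addr_ge0// mulr_ge0// ltW.
move=> x t k t0 nd; have s0 : 0 < alpha ^- k * t.
  by rewrite mulr_gt0// invr_gt0 exprn_gt0.
apply: (@density_sum_le_cat _ _ (alpha * (alpha ^- k * t))).
  by apply: density_sum_le_growth => //; rewrite ler_pM2r// ltW.
case: k nd s0 => [|k] nd s0.
  rewrite expr0 invr1 mul1r.
  have := H x (alpha * t) 0%N (mulr_gt0 alpha0 t0).
  rewrite expr0 mul1r => h; apply: density_sum_leW (h _) _ _ _ => //.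
  by rewrite ler_peMl ?(ltW t0) ?(ltW alpha1).
have E : alpha * (alpha ^- k.+1 * t) = alpha ^- k * t.
  by rewrite exprS invfM -!mulrA mulVKf ?gt_eqF.
rewrite E; have ak0 : 0 < alpha ^- k * t.
  by rewrite mulr_gt0// invr_gt0 exprn_gt0.
have := H x (alpha ^- k * t) k ak0; rewrite mulVKf ?gt_eqF ?exprn_gt0//.
apply=> j jk; rewrite -(subnKC (ltnW jk)) exprD invfM.
rewrite !mulrA mulfV ?mul1r ?gt_eqF ?exprn_gt0//.
by apply: nd; rewrite ltnS leq_subr.
Qed.

(** * The coefficients [Kcoef] *)

Lemma scale_gapP (P S : cube R d) : 0 < side P ->
  side S <= 2 ^+ scale_gap P S * side P /\
  forall j, (j < scale_gap P S)%N -> 2 ^+ j * side P < side S.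
Proof.
move=> s0; have [k tk] := exists_expr_ge (side S) (ltr1n _ 2) s0.
have ex : exists k, side S <= 2 ^+ k * side P by exists k; exact: ltW.
case: (ex_minnP ex) => m tm mmin.
have := @xgetPex nat 0%N [set k : nat | side S <= side (dilate (2 ^+ k) P) /\
  forall j : nat, (j < k)%N -> side (dilate (2 ^+ j) P) < side S].
apply; exists m; split=> // j jm /=.
by rewrite ltNge; apply/negP => /mmin; rewrite leqNgt jm.
Qed.

Lemma KcoefE x s (S : cube R d) : Kcoef n mu (Cube x s) S =
  1 + \sum_(1 <= k < (scale_gap (Cube x s) S).+1) density x (2 ^+ k * s).
Proof. by []. Qed.

Lemma Kcoef_ge1 (P S : cube R d) : 1 <= Kcoef n mu P S.
Proof.
by case: P => x s; rewrite KcoefE lerDl sumr_ge0// => k _; exact: density_ge0.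
Qed.

Lemma Kcoef_le x s (S : cube R d) B : 0 < s ->
  density_sum_le x s (side S) B -> Kcoef n mu (Cube x s) S <= 1 + (B + C0).
Proof.
move=> s0 xB; rewrite KcoefE lerD2l.
have [/= _ lt] := scale_gapP S (s0 : 0 < side (Cube x s)).
case: (scale_gap _ _) lt => [|N] lt.
  rewrite big_geq// addr_ge0 ?(ltW C00)//.
  by have := xB s 0%N (lexx s); rewrite big_ord0; apply.
rewrite big_nat_recr//=; apply: lerD; last first.
  by apply: density_le; rewrite mulr_gt0// exprn_gt0.
rewrite -{1}[1%N]add0n big_addn subn1 /= big_mkord.
under eq_bigr do rewrite addn1 exprSr -mulrA.
apply: xB; first lra.
by move=> k kN; rewrite mulrA -exprSr; apply/ltW/lt.
Qed.

(** An arbitrary dyadic progression interleaves with the one that starts at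
    [s]; each of its cubes is compared with the next larger one of the latter. *)
Lemma density_sum_le_Kcoef x s (S : cube R d) : 0 < s ->
  density_sum_le x s (side S) (2 `^ n * (1 + C0) * Kcoef n mu (Cube x s) S).
Proof.
move=> s0 r N sr rt; have K1 := Kcoef_ge1 (Cube x s) S.
case: N rt => [_|N rt].
  rewrite big_ord0; apply: mulr_ge0; last exact: le_trans K1.
  by rewrite mulr_ge0 ?powR_ge0// addr_ge0 ?(ltW C00).
have r0 : 0 < r by exact: lt_le_trans sr.
have [k rk] := exists_expr_ge r (ltr1n _ 2) s0.
have ex : exists j, r < 2 ^+ j * s by exists k.
case: (ex_minnP ex) => j0 rj jmin.
have {ex jmin} [j jr rj1] : exists2 j, 2 ^+ j * s <= r & r < 2 ^+ j.+1 * s.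
  case: j0 rj jmin => [|j] rj jmin.
    by move: rj; rewrite expr0 mul1r ltNge sr.
  by exists j => //; rewrite leNgt; apply/negP => /jmin; rewrite ltnn.
have [/= tG _] := scale_gapP S (s0 : 0 < side (Cube x s)).
have jNG : (j + N <= scale_gap (Cube x s) S)%N.
  have : 2 ^+ (j + N) * s <= 2 ^+ scale_gap (Cube x s) S * s.
    apply: le_trans tG; apply: le_trans (rt N (ltnSn N)).
    by rewrite addnC exprD -mulrA ler_pM2l// exprn_gt0.
  by rewrite ler_pM2r// ler_eXn2l// ltr1n.
apply: le_trans (_ : \sum_(k < N.+1) 2 `^ n * density x (2 ^+ (k + j.+1) * s) <= _).
  apply: ler_sum => i _; have k0 : 0 < 2 ^+ i :> R by rewrite exprn_gt0.
  apply: density_le_double; rewrite ?mulr_gt0 ?exprn_gt0//.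
    by apply: cube_subset_concentric; rewrite exprD -mulrA ler_pM2l// ltW.
  by rewrite exprD exprS -!mulrA mulrCA ler_pM2l// ler_pM2l//.
rewrite -mulr_sumr -mulrA ler_wpM2l ?powR_ge0//.
rewrite -(big_mkord xpredT (fun i => density x (2 ^+ (i + j.+1) * s))).
have -> : \sum_(0 <= i < N.+1) density x (2 ^+ (i + j.+1) * s) =
    \sum_(j.+1 <= i < (j + N).+2) density x (2 ^+ i * s).
  by rewrite -{2}[j.+1]add0n big_addn subSS -addnS addKn.
apply: le_trans (_ : \sum_(1 <= i < (scale_gap (Cube x s) S).+2)
    density x (2 ^+ i * s) <= _).
  rewrite [leRHS](@big_cat_nat _ _ _ j.+1)//=; last first.
    by rewrite ltnS ltnW// ltnS (leq_trans _ jNG)// leq_addr.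
  rewrite -[leLHS]add0r lerD ?sumr_ge0//; first by move=> i _; exact: density_ge0.
  rewrite [leRHS](@big_cat_nat _ _ _ (j + N).+2)//=; last first.
    by rewrite ltnS leqW// leq_addr.
  by rewrite lerDl sumr_ge0// => i _; exact: density_ge0.
rewrite big_nat_recr//= mulrDl mul1r {1}KcoefE.
apply: lerD; first by rewrite lerDr.
apply: (@le_trans _ _ C0); first by apply: density_le; rewrite mulr_gt0// exprn_gt0.
by rewrite ler_peMr// ltW.
Qed.

(** * Doubling cubes just above a given scale *)

(** The first dilate of side larger than [t] that is doubling lies in
    [extended_cubes]: below it in the chain there is a doubling cube, the given
    one, and every such cube has side at most [t <= 1]. *)
Lemma next_doubling : exists2 c, 0 <= c & forall x s t,
  0 < s -> s <= t -> t <= 1 -> doubling mu alpha beta (Cube x s) ->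
  0 < mass mu (Cube x s) ->
  exists u, [/\ t < u, doubling mu alpha beta (Cube x u),
    extended_cubes mu alpha beta (Cube x u) & density_sum_le x t u c].
Proof.
have [c c0 H] := nondoubling_density_sum.
have [M aM] := alpha_dyadic.
exists (M.+1%:R * C0 + c); first by rewrite addr_ge0// mulr_ge0// ltW.
move=> x s t s0 st t1 ds ms; have t0 : 0 < t by exact: lt_le_trans st.
have exi := exists_expr_ge t alpha1 s0.
case: (ex_minnP exi) => i ti imin.
have small j : (j < i)%N -> alpha ^+ j * s <= t.
  by move=> ji; rewrite leNgt; apply/negP => /imin; rewrite leqNgt ji.
have i0 : (0 < i)%N.
  by rewrite lt0n; apply/eqP => i0; move: ti; rewrite i0 expr0 mul1r ltNge st.
have ai0 : 0 < alpha ^+ i * s by rewrite mulr_gt0// exprn_gt0.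
have mi : 0 < mass mu (Cube x (alpha ^+ i * s)).
  apply: lt_le_trans ms _; apply: le_mass => //; apply: cube_subset_concentric.
  by rewrite ler_peMl ?(ltW s0)// exprn_ege1// ltW.
have [m0 dm0] := exists_doubling ai0 mi.
have exm : exists m,
    `[< doubling mu alpha beta (Cube x (alpha ^+ m * (alpha ^+ i * s))) >].
  by exists m0; exact/asboolP.
case: (ex_minnP exm) => m /asboolP dm mmin.
have nd j : (j < m)%N ->
    ~ doubling mu alpha beta (Cube x (alpha ^+ j * (alpha ^+ i * s))).
  by move=> jm /asboolP/mmin; rewrite leqNgt jm.
set u := alpha ^+ m * (alpha ^+ i * s) in dm *.
have au0 : 0 < u by rewrite mulr_gt0// exprn_gt0.
have uE j : (j <= m + i)%N -> alpha ^- j * u = alpha ^+ (m + i - j) * s.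
  move=> jmi; have -> : u = alpha ^+ (m + i) * s by rewrite /u mulrA -exprD.
  by rewrite -{1}(subnKC jmi) exprD -mulrA mulKf// gt_eqF// exprn_gt0.
exists u; split=> //.
- by apply: (lt_le_trans ti); rewrite ler_peMl ?(ltW ai0)// exprn_ege1// ltW.
- split=> //.
  have exN : exists N,
      (0 < N)%N && `[< doubling mu alpha beta (Cube x (alpha ^- N * u)) >].
    exists (m + i)%N; rewrite addn_gt0 i0 orbT/=; apply/asboolP.
    by rewrite uE// subnn expr0 mul1r.
  case: (ex_minnP exN) => N /andP[N0 /asboolP dN] Nmin.
  exists (Cube x (alpha ^- N * u)).
    exists N; split=> // k /andP[k0 kN] dk.
    have := Nmin k; rewrite k0/= leqNgt kN => /(_ _)/negP; apply; last by [].
    exact/asboolP.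
  have NM : (N <= m + i)%N.
    apply: Nmin; rewrite addn_gt0 i0 orbT/=; apply/asboolP.
    by rewrite uE// subnn expr0 mul1r.
  rewrite /= uE//; apply: le_trans t1; apply: small.
  have mN : (m < N)%N.
    rewrite ltnNge; apply/negP => Nm; apply: (nd (m - N)%N).
      by rewrite ltn_subrL N0 (leq_trans N0 Nm).
    by rewrite mulrA -exprD addnC addnBA// addnC -uE.
  by rewrite ltn_subLR// ltn_add2r.
- apply: (@density_sum_le_cat _ _ (alpha ^+ i * s)); last exact: H.
  apply: density_sum_le_growth => //.
  case: (i) i0 small => // i' _ sm; rewrite exprS -mulrA.
  by apply: ler_pM; rewrite ?(ltW alpha0) ?(ltW aM) ?sm// mulr_ge0 ?exprn_ge0 ?ltW.
Qed.

End Scales.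
Arguments density {R d} mu n x r.
Arguments density_sum_le {R d} mu n x s t B.

(** * Comparison of the three conditions *)

Section Comparison.
Context {R : realType} {d : nat} {mu : {measure set (Rd R d) -> \bar R}}.
Context {n C0 alpha beta eta : R}.
Context (mufin : forall A : set 'rV[R]_d, compact A -> (mu A < +oo)%E).
Context (n0 : 0 < n) (C00 : 0 < C0) (mugrowth : growth n C0 mu).
Context (d0 : (0 < d)%N) (n_le_d : n <= d%:R).
Context (eta1 : 1 < eta) (eta_alpha : eta <= alpha).
Context (alphad_lt : alpha ^+ d < beta).
Implicit Types (x y z : 'rV[R]_d) (r s t u B C : R) (f : Rd R d -> R).

Let alpha1 : 1 < alpha. Proof. exact: lt_le_trans eta1 eta_alpha. Qed.
Let alpha0 : 0 < alpha. Proof. exact: lt_trans alpha1. Qed.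
Let alphan_lt : alpha `^ n < beta.
Proof.
apply: le_lt_trans alphad_lt; rewrite -powR_mulrn ?(ltW alpha0)//.
by apply: ler_powR => //; exact: ltW.
Qed.
Let beta1 : 1 < beta.
Proof. by apply: le_lt_trans alphad_lt; rewrite exprn_ege1// ltW. Qed.
Let beta0 : 0 < beta. Proof. exact: lt_trans beta1. Qed.

Lemma mass_eta_doubling Q : 0 < side Q -> doubling mu alpha beta Q ->
  mass mu (dilate eta Q) <= beta * mass mu Q.
Proof.
move=> Q0; apply: le_trans; apply: le_mass => //.
by apply: cube_subset_concentric; rewrite ler_pM2r.
Qed.

Lemma mass_le_eta Q : 0 < side Q -> mass mu Q <= mass mu (dilate eta Q).
Proof.
case: Q => z l /= l0; apply: le_mass => //.
by apply: cube_subset_concentric; rewrite /= ler_peMl ?ltW.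
Qed.

Lemma osc_null f Q c : loc_integrable mu f -> mass mu Q = 0 ->
  integral_on mu Q (fun x => `|f x - c|) = 0.
Proof.
move=> fint Q0; apply/EFin_inj; rewrite (EFin_osc mufin fint).
rewrite (@ge0_negligible_integral _ _ _ _ _ (cube_set Q))//.
- by rewrite setDv integral_set0.
- exact: measurable_int (integrable_norm_osc mufin fint Q c).
- by rewrite (massE mufin) Q0.
Qed.

Lemma osc0 f Q : integral_on mu Q (fun x => `|f x - 0|) =
  integral_on mu Q (fun x => `|f x|).
Proof. by rewrite /integral_on; under eq_Rintegral do rewrite subr0. Qed.

Local Notation cond4 := (rbmo_cond4 n mu alpha beta).
Local Notation dbl := (doubling mu alpha beta).

(** A small doubling cube is compared with the first concentric doubling cube
    of side larger than one, whose mean is bounded. *)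
Lemma doubling_mean_le : exists2 c, 0 <= c & forall f C,
  loc_integrable mu f -> 0 <= C -> cond4 f C -> forall x s B,
  0 < s -> s <= 1 -> dbl (Cube x s) -> 0 < mass mu (Cube x s) ->
  density_sum_le mu n x s 1 B -> `|mean mu (Cube x s) f| <= C * (c + B).
Proof.
have [c c0 next] := next_doubling mufin n0 C00 mugrowth alpha1 alphan_lt.
exists (2 + c + C0); first by rewrite !addr_ge0// ltW.
move=> f C fint Cge0 [_ H4b H4c] x s B s0 s1 ds ms xB.
have [u [u1 du eu xu]] := next x s 1 s0 s1 (lexx 1) ds ms.
have sub : subcube (Cube x s) (Cube x u).
  by apply: cube_subset_concentric; exact: le_trans s1 (ltW u1).
have mu0 : 0 < mass mu (Cube x u) by apply: lt_le_trans ms _; exact: le_mass.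
have K := Kcoef_le mufin C00 mugrowth (S := Cube x u) s0 (density_sum_le_cat xB xu).
have h1 := H4b (Cube x s) _ (conj s0 s1) eu sub ds du ms mu0.
have u_big : (extended_cubes mu alpha beta `\` @unit_cubes R d) (Cube x u).
  by split=> // -[_] /=; rewrite leNgt u1.
have h2 := H4c _ u_big du mu0.
have h3 := le_trans (mean_norm_le mufin fint mu0) h2.
have h4 := le_trans h1 (ler_wpM2l Cge0 K).
rewrite -(subrK (mean mu (Cube x u) f) (mean mu (Cube x s) f)).
apply: (le_trans (ler_normD _ _)); apply: (le_trans (lerD h4 h3)).
by rewrite le_eqVlt; apply/orP; left; apply/eqP; ring.
Qed.

Let kappa0 : 0 < Num.min 1 (eta - 1). Proof. by rewrite lt_min ltr01 subr_gt0. Qed.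

(** The starting scale of the chains around the points of a cube of side [l]:
    it keeps the cubes of the chain inside the dilate by [eta]. *)
Definition chain_side l := Num.min 1 (eta - 1) * Num.min 1 l.

Lemma chain_side_gt0 l : 0 < l -> 0 < chain_side l.
Proof. by move=> l0; rewrite mulr_gt0// lt_min ltr01. Qed.

Lemma chain_side_eta l : 0 < l -> l + chain_side l <= eta * l.
Proof.
move=> l0; have : chain_side l <= (eta - 1) * l.
  apply: ler_pM; rewrite ?(ltW kappa0) ?le_min ?ler01 ?(ltW l0)//.
    by rewrite ge_min lexx orbT.
  by rewrite ge_min lexx orbT.
lra.
Qed.

Lemma chain_density_sum : exists2 c, 0 <= c & forall x l k, 0 < l ->
  (forall j, (j < k)%N -> ~ dbl (Cube x (alpha ^- j * chain_side l))) ->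
  [/\ 0 < alpha ^- k * chain_side l,
      alpha ^- k * chain_side l <= Num.min 1 l &
      density_sum_le mu n x (alpha ^- k * chain_side l) (Num.min 1 l) c].
Proof.
have [c c0 down] :=
  nondoubling_density_sum_down mufin n0 C00 mugrowth alpha1 alphan_lt.
have [M kM] := exists_expr_ge 1 (ltr1n R 2) kappa0.
exists (c + M.+1%:R * C0); first by rewrite addr_ge0// mulr_ge0// ltW.
move=> x l k l0 ndk; have l00 := chain_side_gt0 l0.
have m0 : 0 < Num.min 1 l by rewrite lt_min ltr01.
split; first by rewrite mulr_gt0// invr_gt0 exprn_gt0.
  apply: (@le_trans _ _ (1 * chain_side l)).
    by rewrite ler_pM2r// invf_le1 ?exprn_gt0// exprn_ege1// ltW.
  by rewrite mul1r /chain_side ler_piMl ?(ltW m0)// ge_min lexx.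
apply: density_sum_le_cat (down x _ k l00 ndk) _.
apply: density_sum_le_growth => //.
by rewrite mulrA ler_peMl ?(ltW m0)// ltW.
Qed.

(** If the densities around [z] are summable up to scale one, the small doubling
    cubes around the points of the cube have bounded means, and the covering
    argument applies to [`|f|] itself.  For [L = l >= 1 / 2] the hypothesis on
    the densities is just the growth condition. *)
Lemma integral_norm_le B : 0 <= B -> exists2 A, 0 <= A & forall f C,
  loc_integrable mu f -> 0 <= C -> cond4 f C -> forall z l L,
  0 < l -> l <= L -> 2^-1 <= L -> density_sum_le mu n z l L B ->
  integral_on mu (Cube z l) (fun x => `|f x|) <=
    A * C * mass mu (Cube z (eta * l)).
Proof.
move=> B0; have [c c0 meanP] := doubling_mean_le.
have [c' c'0 chain] := chain_density_sum.
pose B' := c' + 2 `^ n * (B + 2 * C0 + 2 * C0).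
have D0 : 0 <= B + 2 * C0 + 2 * C0 by have := C00; lra.
have B'0 : 0 <= B' by rewrite addr_ge0// mulr_ge0 ?powR_ge0.
exists ((2 ^ d)%:R * (1 + (c + B'))).
  by apply: mulr_ge0 => //; apply: addr_ge0 => //; exact: addr_ge0.
move=> f C fint Cge0 H4 z l L l0 lL L2 zB; rewrite -osc0 -[_ * _ * C]mulrA.
apply: (osc_covering mufin alpha1 alphad_lt fint _ (chain_side_gt0 l0)) => //=.
- exact: chain_side_eta.
- by apply: mulr_ge0 => //; apply: addr_ge0 => //; exact: addr_ge0.
move=> x k xQ dk ndk; have [s0 sl xs] := chain x l k l0 ndk.
set s := alpha ^- k * _ in dk s0 sl xs *.
have s1 : s <= 1 by apply: (le_trans sl); rewrite ge_min lexx.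
have [/esym m0|m0] := eqVneq 0 (mass mu (Cube x s)).
  by rewrite osc_null// m0 mulr0.
have {}m0 : 0 < mass mu (Cube x s) by rewrite lt_neqAle m0 mass_ge0.
have xB' : density_sum_le mu n x s 1 B'.
  have [l1|l1] := leP 1 l.
    rewrite min_l// in xs; apply: density_sum_leW xs _ _ _ => //.
    by rewrite lerDl mulr_ge0 ?powR_ge0.
  rewrite min_r ?(ltW l1)// in xs.
  apply: density_sum_le_cat xs _.
  have : density_sum_le mu n z l (2 * L) (B + 2 * C0).
    apply: density_sum_le_cat zB _; apply: density_sum_le_twice => //.
    exact: lt_le_trans lL.
  move=> /(density_sum_le_center mufin n0 C00 mugrowth l0 xQ) h.
  by apply: density_sum_leW h _ _ _ => //; lra.
have mb := meanP f C fint Cge0 H4 x s B' s0 s1 dk m0 xB'.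
apply: (le_trans (osc_triangle mufin fint _ (mean mu (Cube x s) f) 0)).
have [H4a _ _] := H4; have := H4a (Cube x s) (conj s0 s1) dk m0.
rewrite subr0 ler_pdivrMl// => h.
apply: (le_trans (lerD h (ler_wpM2r (mass_ge0 _) mb))).
by rewrite le_eqVlt; apply/orP; left; apply/eqP; ring.
Qed.

Lemma tilde_density_sum : exists2 c, 0 <= c & forall z l lt,
  0 < l -> is_tilde mu alpha beta (Cube z l) (Cube z lt) ->
  [/\ l <= lt, dbl (Cube z lt) & density_sum_le mu n z l lt c].
Proof.
have [c c0 geo] := nondoubling_density_sum mufin n0 C00 mugrowth alpha1 alphan_lt.
exists c => // z l lt l0 [m [[->] dt ndt]]; split=> //; last exact: geo.
by rewrite ler_peMl ?(ltW l0)// exprn_ege1// ltW.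
Qed.

Lemma tilde_mean_bound : exists2 A, 0 <= A & forall f C,
  loc_integrable mu f -> 0 <= C -> cond4 f C -> forall z l,
  0 < l -> 2^-1 <= l -> dbl (Cube z l) -> 0 < mass mu (Cube z l) ->
  `|mean mu (Cube z l) f| <= A * C.
Proof.
have CC : 0 <= 1 * C0 by rewrite mul1r ltW.
have [A A0 normA] := integral_norm_le CC.
exists (A * beta); first by rewrite mulr_ge0// ltW.
move=> f C fint Cge0 H4 z l l0 l2 dl ml.
have zB : density_sum_le mu n z l l (1 * C0).
  apply: (density_sum_le_growth mufin C00 mugrowth z (M := 0)) => //.
  by rewrite expr0 mul1r.
have h := normA f C fint Cge0 H4 z l l l0 (lexx l) l2 zB.
apply: (le_trans (mean_norm_le mufin fint ml)).
rewrite ler_pdivrMl//; apply: (le_trans h).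
have := @mass_eta_doubling (Cube z l) l0 dl.
move=> /(ler_wpM2l (mulr_ge0 A0 Cge0)) hh; apply: (le_trans hh).
by rewrite le_eqVlt; apply/orP; left; apply/eqP; ring.
Qed.

(** Around almost every point of [Q] a small doubling cube is compared with
    the tilde of [Q] through a doubling cube that contains both; when the tilde
    is large, the integrals of [`|f|] are bounded and no comparison is needed. *)
Lemma tilde_osc : exists2 A, 0 <= A & forall f C,
  loc_integrable mu f -> 0 <= C -> cond4 f C -> forall z l lt,
  0 < l -> l <= 1 -> is_tilde mu alpha beta (Cube z l) (Cube z lt) ->
  0 < mass mu (Cube z lt) ->
  integral_on mu (Cube z l) (fun x => `|f x - mean mu (Cube z lt) f|) <=
    A * C * mass mu (Cube z (eta * l)).
Proof.
have C0p := C00; have [c c0 til] := tilde_density_sum.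
have [A1 A10 normA] := integral_norm_le c0.
have [A2 A20 meanA] := tilde_mean_bound.
have [cc cc0 chain] := chain_density_sum.
have [cn cn0 next] := next_doubling mufin n0 C00 mugrowth alpha1 alphan_lt.
have p0 : 0 <= 2 `^ n :> R := powR_ge0 _ _.
(* [B1] bounds the densities around [x] from the side of [P] to that of the
   common doubling cube, [B2] those around [z] from the side of the tilde. *)
pose B1 := cc + 2 `^ n * (c + 2 * C0) + 2 * C0 + cn.
pose B2 := 2 `^ n * (B1 + 2 * C0).
have B10 : 0 <= B1.
  have : 0 <= 2 `^ n * (c + 2 * C0) by apply: mulr_ge0 => //; lra.
  by rewrite /B1; lra.
have B20 : 0 <= B2 by apply: mulr_ge0 => //; lra.
pose A3 := 3 + B1 + B2 + 2 * C0.
have A30 : 0 <= A3 by rewrite /A3; lra.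
exists (A1 + A2 + (2 ^ d)%:R * A3).
  by rewrite !addr_ge0// mulr_ge0.
move=> f C fint Cge0 H4 z l lt l0 l1 tl mt.
have [llt dt zB] := til z l lt l0 tl; have lt0 : 0 < lt by exact: lt_le_trans llt.
set b := mean mu (Cube z lt) f.
have me : mass mu (Cube z l) <= mass mu (Cube z (eta * l)).
  exact: (@mass_le_eta (Cube z l)).
have me0 := mass_ge0 (mu := mu) (Cube z (eta * l)).
(* The threshold [1 / 2] leaves room for a doubling of the scale below one. *)
have [lt2|lt2] := leP 2^-1 lt.
  apply: (le_trans (osc_triangle mufin fint _ 0 b)); rewrite osc0 sub0r normrN.
  have h1 := normA f C fint Cge0 H4 z l lt l0 llt lt2 zB.
  have h2 := meanA f C fint Cge0 H4 z lt lt0 lt2 dt mt.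
  have h3 : `|b| * mass mu (Cube z l) <= A2 * C * mass mu (Cube z (eta * l)).
    by apply: ler_pM; rewrite ?mass_ge0.
  have h4 : 0 <= (2 ^ d)%:R * A3 * C * mass mu (Cube z (eta * l)).
    by rewrite !mulr_ge0.
  by rewrite !mulrDl; lra.
apply: (@le_trans _ _ ((2 ^ d)%:R * (A3 * C) * mass mu (Cube z (eta * l))));
    last first.
  by rewrite mulrA ler_wpM2r// ler_wpM2r// lerDr addr_ge0.
apply: (osc_covering mufin alpha1 alphad_lt fint _ (chain_side_gt0 l0)) => //=.
- exact: chain_side_eta.
- by rewrite mulr_ge0.
move=> x k xQ dk ndk; have [s0 sl xs] := chain x l k l0 ndk.
set s := alpha ^- k * _ in dk s0 sl xs *.
rewrite min_r// in sl xs.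
have slt : s <= 2 * lt by lra.
have lt21 : 2 * lt <= 1 by lra.
have s1 : s <= 1 by exact: le_trans lt21.
have [/esym m0|m0] := eqVneq 0 (mass mu (Cube x s)).
  by rewrite osc_null// m0 mulr0.
have {}m0 : 0 < mass mu (Cube x s) by rewrite lt_neqAle m0 mass_ge0.
have [u [ltu du eu xu]] := next x s (2 * lt) s0 slt lt21 dk m0.
have subP : subcube (Cube x s) (Cube x u).
  by apply: cube_subset_concentric; exact: le_trans slt (ltW ltu).
have subT : subcube (Cube z lt) (Cube x u).
  by apply: cube_subset (cube_sym xQ) _; lra.
have muu : 0 < mass mu (Cube x u) by apply: lt_le_trans mt _; exact: le_mass.
have xB1 : density_sum_le mu n x s u B1.
  apply: density_sum_le_cat xu.
  apply: density_sum_le_cat (density_sum_le_twice mufin C00 mugrowth x lt0).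
  apply: density_sum_le_cat xs _.
  exact: density_sum_le_center zB.
have zB2 : density_sum_le mu n z lt u B2.
  apply: (density_sum_le_center mufin n0 C00 mugrowth lt0).
    by apply: cube_subset_concentric (cube_sym xQ).
  by apply: density_sum_leW xB1 _ _ _ => //; lra.
have [H4a H4b _] := H4.
have lt1 : lt <= 1 by lra.
have k1 := Kcoef_le mufin C00 mugrowth (S := Cube x u) s0 xB1.
have k2 := Kcoef_le mufin C00 mugrowth (S := Cube x u) lt0 zB2.
have h1 := H4b (Cube x s) _ (conj s0 s1) eu subP dk du m0 muu.
have h2 := H4b (Cube z lt) _ (conj lt0 lt1) eu subT dt du mt muu.
have h3 := H4a (Cube x s) (conj s0 s1) dk m0.
rewrite ler_pdivrMl// in h3.
apply: (le_trans (osc_triangle mufin fint _ (mean mu (Cube x s) f) b)).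
have h4 : `|mean mu (Cube x s) f - b| <= C * (1 + (B1 + C0)) + C * (1 + (B2 + C0)).
  rewrite -(subrKA (mean mu (Cube x u) f)).
  apply: (le_trans (ler_normD _ _)); rewrite [X in _ + X]distrC.
  apply: lerD; first by apply: (le_trans h1); exact: ler_wpM2l.
  by apply: (le_trans h2); exact: ler_wpM2l.
apply: (le_trans (lerD h3 (ler_wpM2r (mass_ge0 _) h4))).
by rewrite /A3 le_eqVlt; apply/orP; left; apply/eqP; ring.
Qed.

Lemma exists_tilde z l : 0 < l -> 0 < mass mu (Cube z l) ->
  exists lt, is_tilde mu alpha beta (Cube z l) (Cube z lt).
Proof.
move=> l0 ml; have [m0 dm0] := exists_doubling mufin mugrowth alpha1 alphan_lt l0 ml.
have ex : exists m, `[< dbl (Cube z (alpha ^+ m * l)) >].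
  by exists m0; exact/asboolP.
case: (ex_minnP ex) => m /asboolP dm mmin.
exists (alpha ^+ m * l), m; split=> // k km /asboolP/mmin.
by rewrite leqNgt km.
Qed.

Lemma tilde_mass z l lt : 0 < l -> 0 < mass mu (Cube z l) ->
  is_tilde mu alpha beta (Cube z l) (Cube z lt) -> 0 < mass mu (Cube z lt).
Proof.
move=> l0 ml; have [c _ til] := tilde_density_sum => /(til z l lt l0)[llt _ _].
apply: lt_le_trans ml _; apply: le_mass => //.
exact: cube_subset_concentric.
Qed.

(** A tilde of side at least [1 / 2] has a bounded mean, for which zero is as good
    a substitute. *)
Lemma mean_tilde : exists2 A, 0 <= A & forall f C,
  loc_integrable mu f -> 0 <= C -> cond4 f C -> forall z l lt,
  0 < l -> 0 < mass mu (Cube z l) ->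
  is_tilde mu alpha beta (Cube z l) (Cube z lt) ->
  `|mean mu (Cube z l) f - (if lt < 2^-1 then mean mu (Cube z lt) f else 0)| <=
    A * C * (mass mu (Cube z (eta * l)) / mass mu (Cube z l)).
Proof.
have [c c0 til] := tilde_density_sum.
have [A1 A10 normA] := integral_norm_le c0.
have [A2 A20 oscA] := tilde_osc.
exists (A1 + A2); first exact: addr_ge0.
move=> f C fint Cge0 H4 z l lt l0 ml tl; have [llt dt zB] := til z l lt l0 tl.
have e0 : 0 <= mass mu (Cube z (eta * l)) by exact: mass_ge0.
apply: (le_trans (mean_osc mufin fint _ ml)).
rewrite ler_pdivrMl// mulrCA [mass mu _ * (_ / _)]mulrCA mulfV ?gt_eqF// mulr1.
have [lt2|lt2] := ltP lt 2^-1.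
  apply: (@le_trans _ _ (A2 * C * mass mu (Cube z (eta * l)))).
    apply: oscA => //; last exact: tilde_mass tl.
    by apply: (le_trans llt); lra.
  by rewrite ler_wpM2r// ler_wpM2r// lerDr.
rewrite osc0; apply: (@le_trans _ _ (A1 * C * mass mu (Cube z (eta * l)))).
  exact: normA llt lt2 zB.
by rewrite ler_wpM2r// ler_wpM2r// lerDl.
Qed.

(** Up to the side of the larger of the two tildes, and a factor of two beyond,
    the densities around the center of [Q] are controlled by [Kcoef]: the scales
    between the sides of [Q] and [S] make up the coefficient, those above belong
    to one of the two chains without doubling cubes. *)
Lemma pair_density_sum : exists2 c, 0 <= c & forall z l lt y L Lt,
  0 < l -> subcube (Cube z l) (Cube y L) ->
  is_tilde mu alpha beta (Cube z l) (Cube z lt) ->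
  is_tilde mu alpha beta (Cube y L) (Cube y Lt) ->
  density_sum_le mu n z l (2 * Num.max lt Lt)
    (c * Kcoef n mu (Cube z l) (Cube y L)).
Proof.
have C0p := C00; have [c c0 til] := tilde_density_sum.
have p0 : 0 <= 2 `^ n :> R := powR_ge0 _ _.
pose a1 := 2 `^ n * (1 + C0); pose a2 := 2 `^ n * (c + 2 * C0).
have a10 : 0 <= a1 by apply: mulr_ge0 => //; lra.
have a20 : 0 <= a2 by apply: mulr_ge0 => //; lra.
exists (a1 + (a2 + c + 2 * C0)); first by lra.
move=> z l lt y L Lt l0 sub tz ty.
have lL : l <= L by apply: (subcube_side d0 _ sub) => /=; exact: ltW.
have L0 : 0 < L by exact: lt_le_trans lL.
have [llt _ zB] := til z l lt l0 tz; have [LLt _ yB] := til y L Lt L0 ty.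
have zy : cube_set (Cube y L) z by apply: sub; exact/cube_center/ltW.
have K1 := Kcoef_ge1 (n := n) (mu := mu) (Cube z l) (Cube y L).
set K := Kcoef _ _ _ _ in K1 *.
have zLt : density_sum_le mu n z l Lt (a1 * K + a2).
  apply: density_sum_le_cat (density_sum_le_center mufin n0 C00 mugrowth L0 zy yB).
  exact: (density_sum_le_Kcoef mufin n0 C00 mugrowth (S := Cube y L) z l0).
have a1K : 0 <= a1 * K by apply: mulr_ge0 => //; lra.
have zmax : density_sum_le mu n z l (Num.max lt Lt) (a1 * K + a2 + c).
  case: leP => _; first by apply: density_sum_leW zLt _ _ _ => //; lra.
  by apply: density_sum_leW zB _ _ _ => //; lra.
have max0 : 0 < Num.max lt Lt by rewrite lt_max (lt_le_trans l0 llt).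
have h := density_sum_le_cat zmax (density_sum_le_twice mufin C00 mugrowth z max0).
apply: density_sum_leW h _ _ _ => //.
have : a2 + c + 2 * C0 <= (a2 + c + 2 * C0) * K by apply: ler_peMr => //; lra.
by rewrite mulrDl; lra.
Qed.

(** Small tildes are compared through a doubling cube that contains both; large
    ones have bounded means. *)
Lemma tilde_mean_diff : exists2 A, 0 <= A & forall f C,
  loc_integrable mu f -> 0 <= C -> cond4 f C -> forall z l lt y L Lt,
  0 < l -> subcube (Cube z l) (Cube y L) -> 0 < mass mu (Cube z l) ->
  is_tilde mu alpha beta (Cube z l) (Cube z lt) ->
  is_tilde mu alpha beta (Cube y L) (Cube y Lt) ->
  `|(if lt < 2^-1 then mean mu (Cube z lt) f else 0) -
    (if Lt < 2^-1 then mean mu (Cube y Lt) f else 0)| <=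
    C * (A * Kcoef n mu (Cube z l) (Cube y L)).
Proof.
have C0p := C00; have [c c0 til] := tilde_density_sum.
have [A0 A00 pairA] := pair_density_sum.
have [c1 c10 meanP] := doubling_mean_le.
have [cn cn0 next] := next_doubling mufin n0 C00 mugrowth alpha1 alphan_lt.
have p0 : 0 <= 2 `^ n :> R := powR_ge0 _ _.
pose D := 2 `^ n * (cn + 2 * C0).
have D0 : 0 <= D by apply: mulr_ge0 => //; lra.
(* [W] collects the constants of the three cases where some tilde is small. *)
pose W := 2 + c1 + A0 + D + 2 * C0 + 2 `^ n * (A0 + D + 2 * C0).
have q0 : 0 <= 2 `^ n * (A0 + D + 2 * C0) by apply: mulr_ge0 => //; lra.
have W0 : 0 <= W by rewrite /W; lra.
exists W => // f C fint Cge0 H4 z l lt y L Lt l0 sub mz tz ty.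
have lL : l <= L by apply: (subcube_side d0 _ sub) => /=; exact: ltW.
have L0 : 0 < L by exact: lt_le_trans lL.
have [llt dz zB] := til z l lt l0 tz; have [LLt dy yB] := til y L Lt L0 ty.
have lt0 : 0 < lt by exact: lt_le_trans llt.
have Lt0 : 0 < Lt by exact: lt_le_trans LLt.
have zy : cube_set (Cube y L) z by apply: sub; exact/cube_center/ltW.
have my : 0 < mass mu (Cube y L) by apply: lt_le_trans mz _; exact: le_mass.
have mzt := tilde_mass l0 mz tz; have myt := tilde_mass L0 my ty.
have K1 := Kcoef_ge1 (n := n) (mu := mu) (Cube z l) (Cube y L).
have zmax := pairA z l lt y L Lt l0 sub tz ty.
set K := Kcoef _ _ _ _ in K1 zmax *.
have upK a : 0 <= a -> a <= a * K by move=> a0; exact: ler_peMr.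
have A0K : 0 <= A0 * K by apply: mulr_ge0 => //; lra.
have pA0K : 0 <= 2 `^ n * (A0 * K + D + 2 * C0) by apply: mulr_ge0 => //; lra.
have pW : 2 + c1 + A0 * K + D + 2 * C0 + 2 `^ n * (A0 * K + D + 2 * C0) <= W * K.
  have := upK 2 (ler0n R 2); have := upK _ c10; have := upK _ D0.
  have := upK (2 * C0); have := upK (2 `^ n * (D + 2 * C0)).
  have pD : 0 <= 2 `^ n * (D + 2 * C0) by apply: mulr_ge0 => //; lra.
  have : 0 <= 2 * C0 by lra.
  rewrite /W => C20 /(_ pD) h1 /(_ C20) h2 h3 h4 h5.
  have -> : (2 + c1 + A0 + D + 2 * C0 + 2 `^ n * (A0 + D + 2 * C0)) * K =
    2 * K + c1 * K + A0 * K + D * K + 2 * C0 * K + 2 `^ n * (A0 * K) +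
    2 `^ n * (D + 2 * C0) * K by ring.
  have -> : 2 `^ n * (A0 * K + D + 2 * C0) =
     2 `^ n * (A0 * K) + 2 `^ n * (D + 2 * C0) by ring.
  by lra.
have maxl : lt <= Num.max lt Lt by rewrite le_max lexx.
have maxL : Lt <= Num.max lt Lt by rewrite le_max lexx orbT.
have zyLt : cube_set (Cube z Lt) y.
  exact: cube_subset_concentric LLt _ (cube_sym zy).
have [lt2|lt2] := ltP lt 2^-1; have [Lt2|Lt2] := ltP Lt 2^-1.
- have t1 : 2 * Num.max lt Lt <= 1.
    have : Num.max lt Lt <= 2^-1 by rewrite ge_max !ltW.
    by lra.
  have [|u [tu du eu yu]] := next y Lt (2 * Num.max lt Lt) Lt0 _ t1 dy myt.
    by lra.
  have mu0 : 0 < mass mu (Cube y u).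
    apply: lt_le_trans myt _; apply: le_mass => //.
    by apply: cube_subset_concentric; lra.
  have subz : subcube (Cube z lt) (Cube y u).
    apply: cube_subset (cube_sym zyLt) _; lra.
  have suby : subcube (Cube y Lt) (Cube y u).
    by apply: cube_subset_concentric; lra.
  have zu : density_sum_le mu n z l u (A0 * K + D).
    apply: density_sum_le_cat zmax _.
    apply: (density_sum_le_center mufin n0 C00 mugrowth _ _ yu); first by lra.
    by apply: cube_subset_concentric zy; lra.
  have k1 : Kcoef n mu (Cube z lt) (Cube y u) <= 1 + (A0 * K + D + C0).
    apply: (Kcoef_le mufin C00 mugrowth lt0).
    by apply: density_sum_leW zu _ _ _.
  have k2 : Kcoef n mu (Cube y Lt) (Cube y u) <=
      1 + (2 `^ n * (A0 * K + D + 2 * C0) + C0).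
    apply: (Kcoef_le mufin C00 mugrowth Lt0).
    apply: (density_sum_le_center mufin n0 C00 mugrowth Lt0 zyLt).
    by apply: density_sum_leW zu _ _ _ => //; lra.
  have [_ H4b _] := H4.
  have lt1 : lt <= 1 by lra.
  have Lt1 : Lt <= 1 by lra.
  have h1 := H4b (Cube z lt) _ (conj lt0 lt1) eu subz dz du mzt mu0.
  have h2 := H4b (Cube y Lt) _ (conj Lt0 Lt1) eu suby dy du myt mu0.
  rewrite -(subrKA (mean mu (Cube y u) f)).
  apply: (le_trans (ler_normD _ _)); rewrite [X in _ + X]distrC.
  apply: (le_trans (lerD h1 h2)); rewrite -mulrDr; apply: ler_wpM2l => //.
  by lra.
- rewrite subr0.
  have h : density_sum_le mu n z lt 1 (A0 * K).
    by apply: density_sum_leW zmax _ _ _ => //; lra.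
  have lt1 : lt <= 1 by lra.
  apply: (le_trans (meanP f C fint Cge0 H4 z lt _ lt0 lt1 dz mzt h)).
  by apply: ler_wpM2l => //; lra.
- rewrite sub0r normrN.
  have h : density_sum_le mu n z Lt 1 (A0 * K).
    by apply: density_sum_leW zmax _ _ _ => //; lra.
  have Lt1 : Lt <= 1 by lra.
  have h' := density_sum_le_center mufin n0 C00 mugrowth Lt0 zyLt h.
  apply: (le_trans (meanP f C fint Cge0 H4 y Lt _ Lt0 Lt1 dy myt h')).
  apply: ler_wpM2l => //.
  have : 0 <= 2 `^ n * D by exact: mulr_ge0.
  have E : 2 `^ n * (A0 * K + D + 2 * C0) =
    2 `^ n * (A0 * K + 2 * C0) + 2 `^ n * D by ring.
  by rewrite E in pW; lra.
- by rewrite subr0 normr0 mulr_ge0// mulr_ge0//; lra.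
Qed.

(** As [eta <= alpha], normalizing by [mass (dilate eta Q)] or by [mass Q] is
    the same for a doubling cube up to the factor [beta]. *)
Lemma doubling_average Q (I C : R) : 0 < side Q -> dbl Q -> 0 < mass mu Q ->
  0 <= C -> (0 < mass mu (dilate eta Q) -> (mass mu (dilate eta Q))^-1 * I <= C) ->
  (mass mu Q)^-1 * I <= 2 * beta * C.
Proof.
move=> Q0 dQ mQ Cge0 IC; have eQ : 0 < mass mu (dilate eta Q).
  by apply: lt_le_trans mQ _; exact: mass_le_eta.
move: (IC eQ); rewrite !ler_pdivrMl// => h; apply: (le_trans h).
rewrite mulrA; apply: ler_wpM2r => //.
apply: le_trans (mass_eta_doubling Q0 dQ) _.
by rewrite mulrC ler_wpM2l ?mass_ge0// ler_peMl ?(ltW beta0)// ler1n.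
Qed.

Lemma rbmo_cond1_cond4 f C : 0 <= C ->
  rbmo_cond1 n mu alpha beta eta f C -> cond4 f (2 * beta * C).
Proof.
move=> Cge0 [H1a H1b H1c]; split.
- move=> [z l] uQ dQ mQ; have [l0 _] := uQ; apply: doubling_average => // eQ.
  apply: H1a => //.
  by exists 0%N; split=> //; rewrite /dilate /= expr0 mul1r.
- move=> Q S uQ eS QS dQ dS mQ mS.
  apply: (le_trans (H1b Q S uQ eS QS dQ dS mQ mS)).
  rewrite ler_wpM2r ?(le_trans ler01 (Kcoef_ge1 _ _))// ler_peMl//.
  by have := beta1; lra.
- move=> Q eQ dQ mQ; apply: doubling_average => //; last exact: H1c.
  by case: eQ => -[].
Qed.

Lemma rbmo_cond3_cond4 f C : 0 <= C ->
  rbmo_cond3 n mu alpha beta eta f C -> cond4 f (2 * beta * C).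
Proof.
move=> Cge0 [H3a H3b H3c]; split.
- move=> Q uQ dQ mQ; have [l0 _] := uQ; apply: doubling_average => // eQ.
  exact: H3a.
- move=> Q S uQ eS QS dQ dS mQ mS.
  have ratio P : 0 < side P -> dbl P -> 0 < mass mu P ->
      mass mu (dilate eta P) / mass mu P <= beta.
    by move=> P0 dP mP; rewrite ler_pdivrMr//; exact: mass_eta_doubling.
  apply: (le_trans (H3b Q S uQ eS QS mQ mS)).
  have K0 := le_trans ler01 (Kcoef_ge1 (n := n) (mu := mu) Q S).
  have CK := mulr_ge0 Cge0 K0; rewrite -[leRHS]mulrA [leRHS]mulrC.
  apply: ler_wpM2l => //.
  have r1 := ratio Q uQ.1 dQ mQ; have r2 := ratio S eS.1 dS mS.
  by rewrite (_ : 2 * beta = beta + beta) ?lerD//; ring.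
- move=> Q eQ dQ mQ; apply: doubling_average => //; last exact: H3c.
  by case: eQ => -[].
Qed.

Lemma rbmo_cond4_cond1 : exists2 A, 0 <= A & forall f C,
  loc_integrable mu f -> 0 <= C -> cond4 f C ->
  rbmo_cond1 n mu alpha beta eta f (A * C).
Proof.
have [A1 A10 oscA] := tilde_osc.
have [A2 A20 normA] := integral_norm_le (mulr_ge0 ler01 (ltW C00)).
exists (1 + (A1 + A2)); first by rewrite !addr_ge0.
move=> f C fint Cge0 H4; split.
- move=> [z l] Qt [/= l0 l1] tQ eQ mt.
  have [m [QtE _ _]] := tQ; rewrite QtE in tQ mt *.
  rewrite ler_pdivrMl// mulrC.
  apply: le_trans (oscA f C fint Cge0 H4 z l _ l0 l1 tQ mt) _.
  by rewrite ler_wpM2r ?mass_ge0// ler_wpM2r//; lra.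
- have [_ H4b _] := H4; move=> Q S uQ eS QS dQ dS mQ mS.
  apply: (le_trans (H4b Q S uQ eS QS dQ dS mQ mS)).
  rewrite ler_wpM2r ?(le_trans ler01 (Kcoef_ge1 _ _))// ler_peMl//; lra.
- move=> [z l] [[/= l0 _] /not_andP[|/negP]]; first by rewrite l0.
  rewrite -ltNge /= => l1 eQ; rewrite ler_pdivrMl// mulrC.
  have zB := density_sum_le_growth mufin C00 mugrowth z (M := 0) l0 (lexx _).
  rewrite expr0 mul1r in zB.
  apply: le_trans (normA f C fint Cge0 H4 z l l l0 (lexx l) _ zB) _; first by lra.
  by rewrite ler_wpM2r ?mass_ge0// ler_wpM2r//; lra.
Qed.

Lemma rbmo_cond4_cond3 : exists2 A, 0 <= A & forall f C,
  loc_integrable mu f -> 0 <= C -> cond4 f C ->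
  rbmo_cond3 n mu alpha beta eta f (A * C).
Proof.
have [A1 A10 H1] := rbmo_cond4_cond1.
have [A2 A20 meanA] := mean_tilde.
have [A3 A30 diffA] := tilde_mean_diff.
exists (2 * A1 + A2 + A3); first by rewrite !addr_ge0// mulr_ge0.
move=> f C fint Cge0 H4; have [H1a H1b H1c] := H1 f C fint Cge0 H4.
split.
- move=> [z l] [/= l0 l1] mQ eQ.
  have [lt tQ] := exists_tilde l0 mQ; have mt := tilde_mass l0 mQ tQ.
  have h := H1a (Cube z l) _ (conj l0 l1) tQ eQ mt.
  rewrite ler_pdivrMl// in h; rewrite ler_pdivrMl//.
  set b := mean mu (Cube z lt) f in h.
  apply: (le_trans (osc_triangle mufin fint _ b _)).
  have h2 := mean_osc mufin fint b mQ; rewrite ler_pdivlMl// in h2.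
  rewrite distrC [_ * mass mu _]mulrC; apply: (le_trans (lerD h (le_trans h2 h))).
  rewrite -mulrDr ler_wpM2l ?mass_ge0// -mulrDl ler_wpM2r//; lra.
- move=> [z l] [y L] [/= l0 l1] [/= L0 _] QS mQ mS.
  have [lt tQ] := exists_tilde l0 mQ; have [Lt tS] := exists_tilde L0 mS.
  have h1 := meanA f C fint Cge0 H4 z l lt l0 mQ tQ.
  have h2 := meanA f C fint Cge0 H4 y L Lt L0 mS tS.
  have h3 := diffA f C fint Cge0 H4 z l lt y L Lt l0 QS mQ tQ tS.
  have K1 := Kcoef_ge1 (n := n) (mu := mu) (Cube z l) (Cube y L).
  have e1 : 1 <= mass mu (Cube z (eta * l)) / mass mu (Cube z l).
    by rewrite ler_pdivlMr// mul1r; exact: (@mass_le_eta (Cube z l)).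
  have e2 : 1 <= mass mu (Cube y (eta * L)) / mass mu (Cube y L).
    by rewrite ler_pdivlMr// mul1r; exact: (@mass_le_eta (Cube y L)).
  rewrite /dilate /=; set E1 := mass _ _ / _ in h1 e1 *.
  set E2 := mass _ (Cube y _) / _ in h2 e2 *.
  set K := Kcoef _ _ _ _ in h3 K1 *.
  set b1 := (if lt < _ then _ else _) in h1 h3.
  set b2 := (if Lt < _ then _ else _) in h2 h3.
  have -> : mean mu (Cube z l) f - mean mu (Cube y L) f =
      (mean mu (Cube z l) f - b1) + (b1 - b2) - (mean mu (Cube y L) f - b2) by ring.
  apply: (le_trans (ler_normB _ _)).
  apply: (le_trans (lerD (le_trans (ler_normD _ _) (lerD h1 h3)) h2)).
  have E0 : 0 <= E1 + E2 by lra.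
  have CE : 0 <= C * (E1 + E2) by exact: mulr_ge0.
  have KCE : C * (E1 + E2) <= C * (E1 + E2) * K by exact: ler_peMr.
  have CK : 0 <= C * K by apply: mulr_ge0 => //; lra.
  have CKE : C * K <= C * K * (E1 + E2) by apply: ler_peMr => //; lra.
  have h4 := ler_wpM2l A20 KCE; have h5 := ler_wpM2l A30 CKE.
  have h6 : 0 <= 2 * A1 * (C * (E1 + E2) * K).
    by apply: mulr_ge0; [exact: mulr_ge0|apply: mulr_ge0 => //; lra].
  have -> : A2 * C * E1 + C * (A3 * K) + A2 * C * E2 =
    A2 * (C * (E1 + E2)) + A3 * (C * K) by ring.
  have -> : (2 * A1 + A2 + A3) * C * K * (E1 + E2) =
    2 * A1 * (C * (E1 + E2) * K) + A2 * (C * (E1 + E2) * K) +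
    A3 * (C * K * (E1 + E2)) by ring.
  by lra.
- move=> Q eQ mQ; apply: (le_trans (H1c Q eQ mQ)).
  by rewrite ler_wpM2r//; lra.
Qed.

Lemma rbmo_cond_equiv (i j : rbmo_index) : exists2 A, 0 <= A & forall f C,
  loc_integrable mu f -> 0 <= C -> rbmo_cond n mu alpha beta eta i f C ->
  rbmo_cond n mu alpha beta eta j f (A * C).
Proof.
have b0 : 0 <= 2 * beta by rewrite mulr_ge0// ltW.
have to4 : exists2 a, 0 <= a & forall f C,
    loc_integrable mu f -> 0 <= C -> rbmo_cond n mu alpha beta eta i f C ->
    cond4 f (a * C).
  case: i; [exists (2 * beta) => // f C _; exact: rbmo_cond1_cond4
    | exists (2 * beta) => // f C _; exact: rbmo_cond3_cond4
    | by exists 1 => // f C _ _; rewrite mul1r].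
have of4 : exists2 b, 0 <= b & forall f C,
    loc_integrable mu f -> 0 <= C -> cond4 f C ->
    rbmo_cond n mu alpha beta eta j f (b * C).
  case: j; [exact: rbmo_cond4_cond1 | exact: rbmo_cond4_cond3
    | by exists 1 => // f C _ _; rewrite mul1r].
have [a a0 Ha] := to4; have [b b00 Hb] := of4.
exists (b * a) => [|f C fint Cge0 Hi]; first exact: mulr_ge0.
by rewrite -mulrA; apply: Hb => //; [exact: mulr_ge0|exact: Ha].
Qed.

Lemma rbmo_subset i j : rbmo n mu alpha beta eta i `<=` rbmo n mu alpha beta eta j.
Proof.
have [A A0 HA] := rbmo_cond_equiv i j.
move=> f [fint [C Cge0 Hi]]; split=> //; exists (A * C); first exact: mulr_ge0.
exact: HA.
Qed.

Lemma rbmo_norm_ge0 i f : 0 <= rbmo_norm n mu alpha beta eta i f.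
Proof.
rewrite /rbmo_norm; set E := [set C | _].
have [->|/set0P E0] := eqVneq E set0; first by rewrite inf0.
by apply: lb_le_inf => // C [].
Qed.

Lemma rbmo_norm_le i j : exists2 A, 0 <= A & forall f,
  rbmo n mu alpha beta eta i f ->
  rbmo_norm n mu alpha beta eta j f <= A * rbmo_norm n mu alpha beta eta i f.
Proof.
have [A A0 HA] := rbmo_cond_equiv i j.
have A1 : 0 < A + 1 by rewrite ltr_wpDl.
exists (A + 1) => [|f [fint [C' C'0 HC']]]; first exact: ltW.
rewrite -ler_pdivrMl//; apply: lb_le_inf; first by exists C'.
move=> C [Cge0 HC]; rewrite ler_pdivrMl//.
apply: (@le_trans _ _ (A * C)); last by rewrite ler_wpM2r// lerDl.
apply: ge_inf; first by exists 0 => ? [].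
by split; [exact: mulr_ge0|exact: HA].
Qed.

End Comparison.

Theorem theorem3p7 (R : realType) (d : nat) (n C0 : R)
    (mu : {measure set (Rd R d) -> \bar R}) (eta alpha beta : R)
    (hd : (1 <= d)%N) (hn0 : 0 < n) (hnd : n <= d%:R) (hC0 : 0 < C0)
    (hradon : radon mu) (hgrowth : growth n C0 mu)
    (heta : 1 < eta) (halpha : eta <= alpha) (hbeta : alpha ^+ d < beta) :
  [/\ rbmo n mu alpha beta eta rbmo1 = rbmo n mu alpha beta eta rbmo3,
      rbmo n mu alpha beta eta rbmo3 = rbmo n mu alpha beta eta rbmo4
    & exists2 C : R, 1 <= C &
      forall f : Rd R d -> R, rbmo n mu alpha beta eta rbmo1 f ->
      forall i j : rbmo_index,
        C^-1 * rbmo_norm n mu alpha beta eta i f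
          <= rbmo_norm n mu alpha beta eta j f /\
        rbmo_norm n mu alpha beta eta j f
          <= C * rbmo_norm n mu alpha beta eta i f].
Proof.
have [mufin _ _] := hradon.
have sub := rbmo_subset mufin hn0 hC0 hgrowth hd hnd heta halpha hbeta.
split; [by apply/seteqP; split; exact: sub | by apply/seteqP; split; exact: sub|].
have bound i : exists A, 0 <= A /\ forall j f, rbmo n mu alpha beta eta i f ->
    rbmo_norm n mu alpha beta eta j f <= A * rbmo_norm n mu alpha beta eta i f.
  have le := rbmo_norm_le mufin hn0 hC0 hgrowth hd hnd heta halpha hbeta i.
  have [A1 A10 H1] := le rbmo1; have [A3 A30 H3] := le rbmo3.
  have [A4 A40 H4] := le rbmo4.
  exists (A1 + A3 + A4); split=> [|j f fi]; first by rewrite !addr_ge0.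
  have N0 := rbmo_norm_ge0 (n := n) (mu := mu) (alpha := alpha) (beta := beta)
    (eta := eta) i f.
  case: j; [apply: (le_trans (H1 f fi))|apply: (le_trans (H3 f fi))
    |apply: (le_trans (H4 f fi))]; rewrite ler_wpM2r//; lra.
have [A HA] := choice bound.
pose C := 1 + (A rbmo1 + A rbmo3 + A rbmo4).
have AC i : A i <= C.
  have [? _] := HA rbmo1; have [? _] := HA rbmo3; have [? _] := HA rbmo4.
  by rewrite /C; case: i; lra.
have C1 : 1 <= C.
  have [? _] := HA rbmo1; have [? _] := HA rbmo3; have [? _] := HA rbmo4.
  by rewrite /C; lra.
exists C => // f f1 i j.
have le i' j' : rbmo_norm n mu alpha beta eta j' f <=
    C * rbmo_norm n mu alpha beta eta i' f.
  apply: le_trans ((HA i').2 j' f (sub _ _ _ f1)) _.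
  by rewrite ler_wpM2r// rbmo_norm_ge0.
split; last exact: le.
by rewrite ler_pdivrMl ?(lt_le_trans ltr01)//; exact: le.
Qed.
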